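(* Let $Q,N\ge 1$ and let $(a_n)_{n\in \mathbb{Z}[i]}$ be any sequence of complex numbers. Then for every $\varepsilon>0$, \[ \sum_{\substack{q\in \mathbb{Z}[i]\setminus\{0\}\\ \mathcal{N}(q)\le Q}} \ \sum_{\substack{r \bmod{q^2}\\ (r,q)=1}} \left|\sum_{\substack{n\in \mathbb{Z}[i]\\ \mathcal{N}(n)\le N}} a_n \, e\!\left(\Re\!\left(\frac{nr}{q^2}\right)\right)\right|^2 \ll_{\varepsilon} (QN)^{\varepsilon}\left(Q^3+Q^2\sqrt{N}+\sqrt{Q}\,N\right) \sum_{\substack{n\in \mathbb{Z}[i]\\ \mathcal{N}(n)\le N}} |a_n|^2, \] where the implied constant depends only on $\varepsilon$.
   Context: For $q\in\mathbb{Z}[i]$, $\mathcal{N}(q)=\Re(q)^2+\Im(q)^2$ is its norm. $e(x)=e^{2\pi i x}$. The inner sum over $r$ runs over a system of representatives of the residue classes modulo $q^2$ in $\mathbb{Z}[i]$ with $r$ coprime to $q$ (the summand does not depend on the choice of representatives). *)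

(* Defs.v *)
From HB Require Import structures.
From mathcomp Require Import all_boot all_order all_algebra ring finmap.
From mathcomp Require Import complex.
From mathcomp Require Import all_classical all_reals all_analysis.

Set Implicit Arguments.
Unset Strict Implicit.
Unset Printing Implicit Defensive.

Import Order.TTheory GRing.Theory Num.Theory.
Import ComplexField.Normc.

Local Open Scope ring_scope.
Local Open Scope complex_scope.

(* Z[i].  The library makes R[i] a ring only when R is a field; over int it
   supplies the additive group, and the product [mulc] is added here. *)
Definition gaussint : Type := int[i].

HB.instance Definition _ := GRing.Zmodule.on gaussint.

Lemma gauss_mul1z : left_id (1%:C : gaussint) (@ComplexField.mulc int).
Proof. by move=> [a b] /=; rewrite !mul1r !mul0r subr0 addr0. Qed.

Lemma gauss_mulzDl :
  left_distributive (@ComplexField.mulc int) (@ComplexField.addc int).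
Proof. by move=> [a b] [c d] [e f] /=; congr (_ +i* _); ring. Qed.

Lemma gauss_one_neq0 : (1%:C : gaussint) != 0.
Proof. by []. Qed.

HB.instance Definition _ := GRing.Zmodule_isComNzRing.Build gaussint
  (@ComplexField.mulcA int) (@ComplexField.mulcC int)
  gauss_mul1z gauss_mulzDl gauss_one_neq0.

Definition gauss_norm (z : gaussint) : int := complex.Re z ^+ 2 + complex.Im z ^+ 2.

Definition gauss_dvd (d z : gaussint) : Prop := exists c : gaussint, z = c * d.

Definition gauss_coprime (r q : gaussint) : Prop :=
  forall d : gaussint, gauss_dvd d r -> gauss_dvd d q -> gauss_dvd d 1.

(* For q != 0 there are only finitely many classes modulo q ^+ 2, so every
   system of representatives is a finite set. *)
Definition reduced_residues_sq (q : gaussint) (S : {fset gaussint}) : Prop :=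
  (forall r, r \in S -> gauss_coprime r q) /\
  (forall z, gauss_coprime z q -> exists! r, r \in S /\ gauss_dvd (q ^+ 2) (z - r)).

Definition gauss_complex (R : realType) (z : gaussint) : R[i] :=
  (complex.Re z)%:~R +i* (complex.Im z)%:~R.

(* e(x) = exp(2 pi i x) by Euler's formula; the library has no complex
   exponential. *)
Definition e_unit (R : realType) (x : R) : R[i] :=
  cos (2 * pi * x) +i* sin (2 * pi * x).

(* Main.v *)
(* Cut the torus into L^2 squares of side 1/L with L of order sqrt N.  Partial
   summation in both coordinates together with Parseval on the grid bounds the sum,
   over the squares, of the maximum of |S|^2 by O(L^2) times the sum of |a_n|^2, so
   it suffices to bound the number of points r/q^2 in one square.

   Let b/q0^2 be one of these with N(q0) maximal, and put k(q) = r q0^2 - b q^2,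
   which is small.  For two denominators p, q of the square, k(p) - k(q) is
   congruent to -b (p^2 - q^2) modulo q0^2, so it determines p^2 - q^2 up to O(1)
   choices, and (p, q) up to a divisor function.  This gives
   O(Q^eps (1 + Q^2/L)) denominators, each with O(1 + Q^2/L^2) numerators; for
   L <= Q the trivial bound O(Q) for the number of denominators is used instead. *)
Require Import Defs.
From mathcomp Require Import all_boot all_order all_algebra finmap.
From mathcomp Require Import complex.
From mathcomp Require Import all_classical all_reals all_analysis.
From mathcomp Require Import ring lra zify.
Set Implicit Arguments.
Unset Strict Implicit.
Unset Printing Implicit Defensive.
Import Order.TTheory GRing.Theory Num.Theory.
Import ComplexField.Normc.
Import numFieldNormedType.Exports.
Local Open Scope ring_scope.
Local Open Scope complex_scope.
Local Open Scope classical_set_scope.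

(** Pairs of denominators are counted because single ones give too little. The congruence k(q) = -b
    q^2 modulo q0^2 already fixes q^2 up to O(1) choices, but k(q) ranges over a disc with O(1 +
    Q^4/L^2) points, and this would be the bound. The differences k(p) - k(q) range over a disc of
    the same order while (p, q) runs over the square of the set of denominators, so a square root is
    gained and 1 + Q^2/L results. The price is the number of solutions of p^2 - q^2 = m, which is a
    divisor function for m != 0; the pairs with m = 0 have q = p or q = -p and contribute only
    linearly. Maximality of N(q0) makes N(p^2 - q^2) at most 4 N(q0^2), which is what turns a
    residue class modulo q0^2 into O(1) values of m. *)

(** * Arithmetic of Z[i]: norm, divisibility, Euclid, primes *)

Lemma gauss_mulE (a b c d : int) :
  ((a +i* b : gaussint) * (c +i* d : gaussint)) =
  (a * c - b * d) +i* (a * d + b * c) :> gaussint.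
Proof. by []. Qed.

Lemma gauss_normM (x y : gaussint) :
  gauss_norm (x * y) = gauss_norm x * gauss_norm y.
Proof. by case: x y => [a b] [c d]; rewrite gauss_mulE /gauss_norm /=; ring. Qed.

Lemma gauss_normX (x : gaussint) n : gauss_norm (x ^+ n) = gauss_norm x ^+ n.
Proof.
by elim: n => [|n IH]; rewrite ?exprS ?gauss_normM ?IH// /gauss_norm /= expr1n.
Qed.

Lemma gauss_norm_ge0 (x : gaussint) : 0 <= gauss_norm x.
Proof. by rewrite addr_ge0 ?sqr_ge0. Qed.

Lemma gauss_norm_eq0 (x : gaussint) : (gauss_norm x == 0) = (x == 0).
Proof.
case: x => a b; rewrite /gauss_norm /= paddr_eq0 ?sqr_ge0// !sqrf_eq0.
by apply/andP/eqP => [[/eqP -> /eqP ->]//|[-> ->]].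
Qed.

Lemma gauss_norm_ge1 (x : gaussint) : (1 <= gauss_norm x) = (x != 0).
Proof. by rewrite -gauss_norm_eq0; have := gauss_norm_ge0 x; lia. Qed.

Lemma gauss_normB_le (x y : gaussint) :
  gauss_norm (x - y) <= 2 * (gauss_norm x + gauss_norm y).
Proof.
case: x y => [a b] [c d]; rewrite /gauss_norm /=.
by have := sqr_ge0 (a + c); have := sqr_ge0 (b + d); rewrite !expr2; lia.
Qed.

Lemma gauss_mulf_eq0 (x y : gaussint) : (x * y == 0) = (x == 0) || (y == 0).
Proof. by rewrite -!gauss_norm_eq0 gauss_normM mulf_eq0. Qed.

Lemma gauss_mulfI (z : gaussint) : z != 0 -> injective ( *%R z).
Proof.
move=> z0 x y /eqP; rewrite -subr_eq0 -mulrBr gauss_mulf_eq0 (negPf z0) /=.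
by rewrite subr_eq0 => /eqP.
Qed.

Lemma gauss_expf_neq0 (x : gaussint) n : x != 0 -> x ^+ n != 0.
Proof. by rewrite -!gauss_norm_ge1 gauss_normX => x1; exact: exprn_ege1. Qed.

Lemma gauss_dvd_refl (x : gaussint) : gauss_dvd x x.
Proof. by exists 1; rewrite mul1r. Qed.

Lemma gauss_dvd_trans (x y z : gaussint) :
  gauss_dvd x y -> gauss_dvd y z -> gauss_dvd x z.
Proof. by move=> [c ->] [d ->]; exists (d * c); rewrite mulrA. Qed.

Lemma gauss_dvdMl (c x y : gaussint) : gauss_dvd x y -> gauss_dvd x (c * y).
Proof. by move=> [d ->]; exists (c * d); rewrite mulrA. Qed.

Lemma gauss_dvdD (x y z : gaussint) :
  gauss_dvd x y -> gauss_dvd x z -> gauss_dvd x (y + z).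
Proof. by move=> [c ->] [d ->]; exists (c + d); rewrite mulrDl. Qed.

Lemma gauss_dvdN (x y : gaussint) : gauss_dvd x y -> gauss_dvd x (- y).
Proof. by move=> [c ->]; exists (- c); rewrite mulNr. Qed.

Lemma gauss_dvd_norm_le (x y : gaussint) :
  y != 0 -> gauss_dvd x y -> gauss_norm x <= gauss_norm y.
Proof.
move=> y0 [c yE]; move: y0; rewrite {}yE gauss_mulf_eq0 gauss_normM.
rewrite negb_or -!gauss_norm_ge1 => /andP[c1 x1].
by rewrite ler_peMl// (le_trans _ x1).
Qed.

Lemma gauss_unit_norm (u : gaussint) : gauss_norm u = 1 -> gauss_dvd u 1.
Proof.
case: u => a b; rewrite /gauss_norm /= => ab1; exists (a -i* b).
by rewrite gauss_mulE; congr (_ +i* _); rewrite ?[RHS]/=; lia.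
Qed.

Lemma nearest_int (a n : int) : 0 < n -> exists k, `|a - k * n| *+ 2 <= n.
Proof.
move=> n0; exists ((a *+ 2 + n) %/ (n *+ 2))%Z.
have := divz_eq (a *+ 2 + n) (n *+ 2).
have := modz_ge0 (a *+ 2 + n) (d := n *+ 2).
have := ltz_pmod (a *+ 2 + n) (d := n *+ 2).
set k := (_ %/ _)%Z; set t := (_ %% _)%Z => h1 h2 h3.
have {}h1 := h1 ltac:(lia); have {}h2 := h2 ltac:(lia).
have -> : `|a - k * n| *+ 2 = `|(a - k * n) *+ 2| by lia.
have -> : (a - k * n) *+ 2 = t - n by lia.
by lia.
Qed.

(** Round both coordinates of x conj(y) / N(y) to nearest integers: each error is at most 1/2, so
    the remainder has norm at most N(y)/2. The inequality is multiplied by N(y) to stay in the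
    integers. *)
Lemma gauss_euclid (x y : gaussint) : y != 0 ->
  exists q, gauss_norm (x - q * y) < gauss_norm y.
Proof.
move=> y0; have n0 : 0 < gauss_norm y by have := gauss_norm_ge1 y; lia.
set n := gauss_norm y in n0 *; case: y @n y0 n0 => c d n y0 n0.
case: x => a b.
have [k hk] := nearest_int (a * c + b * d) n0.
have [l hl] := nearest_int (b * c - a * d) n0.
exists (k +i* l); rewrite -(ltr_pM2r n0).
have -> : gauss_norm ((a +i* b : gaussint) - (k +i* l : gaussint) * (c +i* d)) * n =
   (a * c + b * d - k * n) ^+ 2 + (b * c - a * d - l * n) ^+ 2.
  by rewrite gauss_mulE /n /gauss_norm /=; ring.
rewrite -(real_normK (num_real (_ - k * n))) -(real_normK (num_real (_ - l * n))).
move: hk hl; set u := `|_|; set v := `|_| => hk hl.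
have u0 : 0 <= u := normr_ge0 _; have v0 : 0 <= v := normr_ge0 _.
have : (u *+ 2) * (u *+ 2) <= n * n by rewrite ler_pM// mulrn_wge0.
have : (v *+ 2) * (v *+ 2) <= n * n by rewrite ler_pM// mulrn_wge0.
have : 0 < n * n by rewrite mulr_gt0.
by rewrite !expr2; lia.
Qed.

Lemma gauss_bezout (a b : gaussint) :
  exists g u v, [/\ g = u * a + v * b, gauss_dvd g a & gauss_dvd g b].
Proof.
have [n] := ubnP `|gauss_norm b|%N; elim: n => // n IH in a b *; rewrite ltnS => bn.
have [->|b0] := eqVneq b 0.
  by exists a, 1, 0; split; [ring|exact: gauss_dvd_refl|exists 0; rewrite mul0r].
have [q hq] := gauss_euclid a b0.
have [|g [u [v [gE gb gr]]]] := IH b (a - q * b).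
  by have := gauss_norm_ge0 (a - q * b); lia.
exists g, v, (u - v * q); split=> //; first by rewrite gE; ring.
by rewrite -(subrK (q * b) a); apply: gauss_dvdD => //; apply: gauss_dvdMl.
Qed.

Lemma gauss_coprime_bezout (a b : gaussint) :
  gauss_coprime a b -> exists u v, u * a + v * b = 1.
Proof.
have [g [u [v [gE ga gb]]]] := gauss_bezout a b.
move=> /(_ g ga gb)[c cE]; exists (c * u), (c * v).
by rewrite cE gE; ring.
Qed.

Definition gauss_prime (p : gaussint) :=
  1 < gauss_norm p /\
  forall x y, gauss_dvd p (x * y) -> gauss_dvd p x \/ gauss_dvd p y.

(* A non-unit divisor of minimal norm is prime. *)
Lemma gauss_prime_dvd (m : gaussint) : 1 < gauss_norm m ->
  exists2 p, gauss_prime p & gauss_dvd p m.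
Proof.
have [n] := ubnP `|gauss_norm m|%N; elim: n => // n IH in m *; rewrite ltnS => mn m1.
have [[d [dm d1 dlt]]|nod] := pselect (exists d, [/\ gauss_dvd d m,
    1 < gauss_norm d & gauss_norm d < gauss_norm m]).
  have [|//|p pp pd] := IH d; first by lia.
  by exists p => //; exact: gauss_dvd_trans dm.
exists m; last exact: gauss_dvd_refl.
split=> // x y mxy.
(* As [m] has no proper non-unit divisor, the gcd [g] of [m] and [x] is either a unit, and then [m]
   divides [y], or an associate of [m], and then [m] divides [x]. *)
have [g [u [v [gE gm gx]]]] := gauss_bezout m x.
have m0 : m != 0 by rewrite -gauss_norm_ge1 ltW.
have gle := gauss_dvd_norm_le m0 gm.
have g0 : g != 0.
  by apply/eqP => g0; case: gm => c; rewrite g0 mulr0 => /eqP; exact/negP.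
have : gauss_norm g = 1 \/ gauss_norm g = gauss_norm m.
  have [g1|] := eqVneq (gauss_norm g) 1; [by left|right].
  apply/eqP/negPn/negP => gm'; apply: nod; exists g; split=> //.
    by move: g0; rewrite -gauss_norm_ge1; lia.
  by lia.
case=> [g1|gmE].
  have [c cE] := gauss_unit_norm g1; right.
  have -> : y = c * u * y * m + c * v * (x * y).
    by transitivity (1 * y); [rewrite mul1r|rewrite cE gE; ring].
  by apply: gauss_dvdD; [exists (c * u * y)|exact: gauss_dvdMl].
left; case: gm => c mE; apply: gauss_dvd_trans gx.
have /gauss_unit_norm[e eE] : gauss_norm c = 1.
  apply: (@mulIf _ (gauss_norm g)); first by rewrite gauss_norm_eq0.
  by rewrite -gauss_normM -mE mul1r.
by exists e; rewrite mE mulrA -eE mul1r.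
Qed.

(** Each factor p of p^e m = c d lies in c or in d; it is cancelled there and moves into p^j only in
    the second case. Hence p^e m has at most e + 1 times as many divisors as m. *)
Lemma gauss_dvd_primeX (p m d : gaussint) e : gauss_prime p ->
  gauss_dvd d (p ^+ e * m) ->
  exists j d', [/\ (j <= e)%N, gauss_dvd d' m & d = p ^+ j * d'].
Proof.
move=> [p1 pp]; have p0 : p != 0 by rewrite -gauss_norm_ge1 ltW.
elim: e d => [|e IH] d; first by rewrite mul1r => dm; exists 0%N, d; rewrite mul1r.
move=> [c]; rewrite exprS -mulrA => cd.
have : gauss_dvd p (c * d) by rewrite -cd mulrC; exists (p ^+ e * m).
move=> /pp[[c' cE]|[d' dE]].
  have [|j [d' [je dm ->]]] := IH d; last by exists j, d'; rewrite leqW.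
  by exists c'; apply: (gauss_mulfI p0); rewrite cd cE; ring.
have [|j [d'' [je dm d'E]]] := IH d'.
  by exists c; apply: (gauss_mulfI p0); rewrite cd dE; ring.
by exists j.+1, d''; split=> //; rewrite dE d'E exprS; ring.
Qed.

Lemma gauss_prime_val (p m : gaussint) : m != 0 -> gauss_dvd p m ->
  1 < gauss_norm p ->
  exists e m', [/\ (0 < e)%N, m = p ^+ e * m' & ~ gauss_dvd p m'].
Proof.
have [n] := ubnP `|gauss_norm m|%N; elim: n => // n IH in m *; rewrite ltnS => mn m0.
move=> [c mE] p1.
have c0 : c != 0 by move: m0; rewrite mE gauss_mulf_eq0 negb_or => /andP[].
have [pc|npc] := pselect (gauss_dvd p c); last first.
  by exists 1%N, c; rewrite mE mulrC.
have [||//|//|e [m' [e0 cE npm]]] := IH c => //.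
  have : gauss_norm c * 1 < gauss_norm c * gauss_norm p.
    by rewrite ltr_pM2l//; have := gauss_norm_ge1 c; lia.
  by rewrite -gauss_normM -mE; have := gauss_norm_ge0 c; lia.
by exists e.+1, m'; split=> //; rewrite mE cE exprS; ring.
Qed.

(** * Counting by covering lists, and the divisor bound *)

(** An upper bound for a cardinality that presupposes no finiteness proof: the list may repeat
    entries or leave [A], so bounds pass to subsets, images and unions without any injectivity. *)
Definition covered (R : realType) (T : eqType) (A : set T) (x : R) :=
  exists2 s : seq T, (size s)%:R <= x & forall z, A z -> z \in s.

Lemma covered_le (R : realType) (T : eqType) (A B : set T) (x y : R) :
  A `<=` B -> x <= y -> covered B x -> covered A y.
Proof.
move=> AB xy [s sx sB]; exists s; first exact: le_trans xy.
by move=> z /AB /sB.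
Qed.

Lemma covered_size (R : realType) (T : eqType) (A : set T) (x : R) (s : seq T) :
  uniq s -> (forall z, z \in s -> A z) -> covered A x -> (size s)%:R <= x.
Proof.
move=> us sA [t tx tA]; apply: le_trans tx; rewrite ler_nat.
by apply: uniq_leq_size => // z /sA /tA.
Qed.

Lemma covered_bind (R : realType) (T U : eqType) (A : set T) (B : T -> set U)
    (x y : R) : 0 <= y -> covered A x -> (forall a, A a -> covered (B a) y) ->
  covered [set u | exists2 a, A a & B a u] (x * y).
Proof.
move=> y0 [s sx sA] AB.
have /choice[f fP] : forall a, exists t : seq U, (size t)%:R <= y /\
    (A a -> forall u, B a u -> u \in t).
  move=> a; have [Aa|nAa] := pselect (A a); last by exists [::].
  by have [t ty tB] := AB a Aa; exists t.
exists (flatten (map f s)).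
  apply: le_trans (ler_wpM2r y0 sx).
  elim: s {sx sA} => [|a s IH]; first by rewrite mul0r.
  by rewrite /= size_cat natrD -addn1 addnC natrD mulrDl mul1r lerD ?(fP a).1.
by move=> u [a Aa Bu]; apply/flatten_mapP; exists a; [exact: sA|exact: (fP a).2].
Qed.

Lemma covered_image (R : realType) (T U : eqType) (A : set T) (f : T -> U) (x : R) :
  covered A x -> covered (f @` A) x.
Proof.
move=> [s sx sA]; exists (map f s); first by rewrite size_map.
by move=> _ [a /sA sa <-]; exact: map_f.
Qed.

(** With s the integer part of sqrt B, both coordinates lie in [-s, s], and (2s + 1)^2 <= 8 s^2 + 1.
    The form 8B + 1 remains sharp for small radii, where only 0 is left. *)
Lemma covered_ball (R : realType) (B : R) : 0 <= B ->
  covered [set z : gaussint | (gauss_norm z)%:~R <= B] (8 * B + 1).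
Proof.
move=> B0; pose s := Num.truncn (Num.sqrt B).
have /andP[sB Bs] := truncn_itv (sqrtr_ge0 B); rewrite -/s in sB Bs.
have {}sB : (s ^ 2)%:R <= B by rewrite natrX -(sqr_sqrtr B0) lerXn2r ?nnegrE ?sqrtr_ge0.
have {}Bs : B < (s.+1 ^ 2)%:R.
  by rewrite natrX -[B]sqr_sqrtr// ltrXn2r ?nnegrE ?sqrtr_ge0.
pose l := [seq (i%:Z - s%:Z) | i <- iota 0 s.*2.+1].
exists [seq (a +i* b : gaussint) | a <- l, b <- l].
  rewrite size_allpairs size_map size_iota.
  have h : (s.*2.+1 * s.*2.+1 <= 8 * s ^ 2 + 1)%N by nia.
  apply: le_trans (_ : (8 * s ^ 2 + 1)%:R <= _); first by rewrite ler_nat.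
  by rewrite natrD natrM lerD2r ler_wpM2l.
move=> [a b] hz; apply/allpairsP; exists (a, b); split=> //=.
- suff: (a ^+ 2 < (s.+1 ^ 2)%:Z).
    move=> h; apply/mapP; exists (absz (a + s%:Z)); last by nia.
    by rewrite mem_iota; nia.
  rewrite -(ltr_int R); apply: le_lt_trans Bs; apply: (le_trans _ hz).
  by rewrite ler_int /gauss_norm /= lerDl sqr_ge0.
- suff: (b ^+ 2 < (s.+1 ^ 2)%:Z).
    move=> h; apply/mapP; exists (absz (b + s%:Z)); last by nia.
    by rewrite mem_iota; nia.
  rewrite -(ltr_int R); apply: le_lt_trans Bs; apply: (le_trans _ hz).
  by rewrite ler_int /gauss_norm /= lerDr sqr_ge0.
Qed.

(** Bernoulli's inequality. In the divisor bound it pays for the e + 1 powers of a prime of small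
    norm. *)
Lemma succn_le_powR (R : realType) (x : R) : 1 < x ->
  exists2 C : R, 1 <= C & forall y e, x <= y -> e.+1%:R <= C * y ^+ e.
Proof.
move=> x1; have d0 : 0 < x - 1 by rewrite subr_gt0.
exists (1 + (x - 1)^-1); first by rewrite lerDl invr_ge0 ltW.
move=> y e xy.
have bern : 1 + e%:R * (x - 1) <= y ^+ e.
  elim: e => [|e IH]; first by rewrite mul0r addr0.
  rewrite exprS; apply: le_trans (_ : x * (1 + e%:R * (x - 1)) <= _); last first.
    have x0 : 0 <= x by rewrite ltW// (lt_trans _ x1).
    by rewrite ler_pM// addr_ge0// mulr_ge0// ltW.
  rewrite -subr_ge0 -natr1.
  have -> : x * (1 + e%:R * (x - 1)) - (1 + (e%:R + 1) * (x - 1)) =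
    e%:R * (x - 1) ^+ 2 by ring.
  by rewrite mulr_ge0 ?sqr_ge0.
apply: le_trans (ler_wpM2l _ bern); last by rewrite addr_ge0 ?invr_ge0 ?(ltW d0).
have -> : (1 + (x - 1)^-1) * (1 + e%:R * (x - 1)) =
  e.+1%:R + (x - 1)^-1 + e%:R * (x - 1).
  by rewrite -natr1; field; rewrite gt_eqF.
by rewrite -addrA lerDl addr_ge0 ?invr_ge0 ?mulr_ge0 ?(ltW d0).
Qed.

Lemma ltn_count (T : eqType) (a b : pred T) (s : seq T) (x : T) :
  subpred a b -> x \in s -> b x -> ~~ a x -> (count a s < count b s)%N.
Proof.
move=> ab xs bx nax; have := count_predC a [seq y <- s | b y].
rewrite !count_filter size_filter => <-; set u := count (predI a b) s.
have -> : count a s = u by apply: eq_count => y /=; case: (boolP (a y)) => // /ab ->.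
rewrite -addn1 leq_add2l -has_count; apply/hasP; exists x => //.
by rewrite /= bx nax.
Qed.

(** Strip the full power p^e of one prime at a time. The factor e + 1 is absorbed by N(p)^(eps e)
    when N(p)^eps > 2; otherwise it costs an additional constant [C0], which happens a bounded
    number of times. *)
Lemma divisor_bound (R : realType) (eps : R) : 0 < eps ->
  exists2 C : R, 1 <= C & forall m : gaussint, m != 0 ->
    covered [set d | gauss_dvd d m] (C * (gauss_norm m)%:~R `^ eps).
Proof.
move=> eps0; pose n (z : gaussint) : R := (gauss_norm z)%:~R.
have n0 z : 0 <= n z by rewrite ler0z gauss_norm_ge0.
have x1 : 1 < 2 `^ eps :> R.
  by rewrite -[ltLHS](congr1 (fun f => f eps) (powR1 R)) gt0_ltr_powR ?nnegrE// ltr1n.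
have [C0 C1 C0P] := succn_le_powR x1.
have B0 : 0 <= 2 `^ eps^-1 :> R := powR_ge0 _ _.
have [T _ TP] := covered_ball B0.
(* A budget for the small primes: it drops whenever one of them is stripped, and never exceeds
   [size T]. Keeping [k m] in the exponent is what lets the induction close. *)
pose k m := count (fun z => `[< 1 < gauss_norm z /\ gauss_dvd z m >]) T.
suff H m : m != 0 -> covered [set d | gauss_dvd d m] (9 * C0 ^+ k m * n m `^ eps).
  exists (9 * C0 ^+ size T).
    rewrite (le_trans (exprn_ege1 (size T) C1))// ler_peMl ?ler1n//.
    by rewrite exprn_ge0 ?(le_trans ler01).
  move=> m m0; apply: covered_le (H m m0) => //.
  by rewrite ler_wpM2r ?powR_ge0// ler_wpM2l// ler_weXn2l// count_size.
have [N] := ubnP `|gauss_norm m|%N; elim: N => // N IH in m *.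
rewrite ltnS => mN m0.
have [m1|m1] := leP (gauss_norm m) 1.
  have {}m1 : gauss_norm m = 1 by move: m0; rewrite -gauss_norm_ge1; lia.
  (* Divisors of a unit lie in the ball of radius 1, whose bound 8 + 1 is the factor 9. *)
  apply: covered_le (covered_ball (ler01 : 0 <= 1 :> R)).
    by move=> d /= /(gauss_dvd_norm_le m0); rewrite m1 -(ler_int R).
  rewrite /n m1 powR1 mulr1 mulr1.
  have -> : 8 + 1 = 9 :> R by rewrite natr1.
  by rewrite ler_peMr// exprn_ege1.
have [p pp pm] := gauss_prime_dvd m1.
have [e [m' [e0 mE npm']]] := gauss_prime_val m0 pm pp.1.
have m'0 : m' != 0 by move: m0; rewrite mE gauss_mulf_eq0 negb_or => /andP[].
have p0 : p != 0 by rewrite -gauss_norm_ge1 ltW// pp.1.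
have m'm : gauss_dvd m' m by rewrite mE; exists (p ^+ e).
have nm : n m = n p ^+ e * n m' by rewrite /n mE gauss_normM gauss_normX rmorphM rmorphXn.
have lem' : (`|gauss_norm m'| < N)%N.
  have : gauss_norm m' < gauss_norm m.
    rewrite mE gauss_normM gauss_normX ltr_pMl; last by move: m'0; rewrite -gauss_norm_ge1; lia.
    by rewrite exprn_egt1 ?pp.1// -lt0n.
  by have := gauss_norm_ge0 m'; lia.
have /(covered_bind (B := fun d' => [set p ^+ j * d' | j in [set j | (j <= e)%N]])
   (y := e.+1%:R)) := IH m' lem' m'0.
have /[swap]/[apply] : 0 <= e.+1%:R :> R by [].
have /[swap]/[apply] : forall a, gauss_dvd a m' ->
    covered [set p ^+ j * a | j in [set j | (j <= e)%N]] (e.+1%:R : R).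
  move=> a _; apply: covered_image; exists (iota 0 e.+1); first by rewrite size_iota.
  by move=> j; rewrite mem_iota.
apply: covered_le.
  move=> d; rewrite /= mE => /(gauss_dvd_primeX pp)[j [d' [je d'm' ->]]].
  by exists d' => //; exists j.
have -> : n m `^ eps = (n p `^ eps) ^+ e * n m' `^ eps.
  rewrite nm powRM ?exprn_ge0// -(powR_mulrn e (n0 p)).
  by rewrite -powR_mulrn ?powR_ge0// powRAC.
have kle : (k m' <= k m)%N.
  by apply: sub_count => z /asboolP[z1 zm]; apply/asboolP; split=> //; exact: gauss_dvd_trans m'm.
have -> : 9 * C0 ^+ k m' * n m' `^ eps * e.+1%:R =
  9 * n m' `^ eps * (C0 ^+ k m' * e.+1%:R) by ring.
have -> : 9 * C0 ^+ k m * (n p `^ eps ^+ e * n m' `^ eps) =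
  9 * n m' `^ eps * (C0 ^+ k m * n p `^ eps ^+ e) by ring.
rewrite ler_wpM2l ?mulr_ge0 ?powR_ge0//.
have C00 : 0 <= C0 := le_trans ler01 C1.
(* A small [p] belongs to [T], divides [m] and not [m'], so one factor [C0] is available. For a
   large [p], e + 1 <= 2^e <= N(p)^(eps e). *)
have [pT|pT] := leP (n p) (2 `^ eps^-1).
  have kT : (k m' < k m)%N.
    apply: (@ltn_count _ _ _ _ p) => //.
    - move=> z /asboolP[z1 zm]; apply/asboolP; split=> //.
      exact: gauss_dvd_trans m'm.
    - exact: TP.
    - by apply/asboolP; split=> //; exact: pp.1.
    - by apply/asboolP => -[].
  apply: le_trans (_ : C0 ^+ (k m').+1 * n p `^ eps ^+ e <= _).
    rewrite exprSr -mulrA ler_wpM2l ?exprn_ge0// C0P//.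
    rewrite ge0_ler_powR ?nnegrE ?(ltW eps0)// -[leLHS]/((2%:Z)%:~R : R) ler_int.
    by have := pp.1; lia.
  by rewrite ler_wpM2r ?exprn_ge0 ?powR_ge0// ler_weXn2l.
rewrite ler_pM ?exprn_ge0//; first by rewrite ler_weXn2l.
apply: le_trans (_ : 2 ^+ e <= _); first by rewrite -natrX ler_nat ltn_expl.
rewrite lerXn2r ?nnegrE ?powR_ge0//.
have -> : 2 = (2 `^ eps^-1) `^ eps :> R.
  by rewrite -powRrM mulVf ?powRr1 ?gt_eqF.
by rewrite ge0_ler_powR ?nnegrE// ltW.
Qed.

(** * Counting denominators and fractions in one square *)

Lemma covered_setU (R : realType) (T : eqType) (A B : set T) (x y : R) :
  covered A x -> covered B y -> covered (A `|` B) (x + y).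
Proof.
move=> [s sx sA] [t ty tB]; exists (s ++ t); first by rewrite size_cat natrD lerD.
by move=> z [/sA|/tB]; rewrite mem_cat => ->; rewrite ?orbT.
Qed.

Lemma covered_subsingleton (R : realType) (T : eqType) (A : set T) :
  (forall x y, A x -> A y -> x = y) -> covered A (1 : R).
Proof.
move=> A1; have [[x Ax]|nA] := pselect (exists x, A x).
  by exists [:: x] => // y Ay; rewrite (A1 y x)// mem_head.
by exists [::] => // x Ax; exfalso; apply: nA; exists x.
Qed.

Lemma gauss_coprimeX2 (b q : gaussint) : gauss_coprime b q ->
  exists u v, u * b + v * q ^+ 2 = 1.
Proof.
move=> /gauss_coprime_bezout[u [v uv]].
exists (u ^+ 2 * b + u * v * q *+ 2), (v ^+ 2).
by transitivity ((u * b + v * q) ^+ 2); [ring|rewrite uv expr1n].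
Qed.

(** As b is invertible modulo r, all such m lie in one class. Two of them differ by c r with N(c r)
    <= 2 (4 + 4) N(r), so N(c) <= 16, and 8 * 16 + 1 = 129. *)
Lemma covered_residue (R : realType) (b r k : gaussint) : r != 0 ->
  (exists u v, u * b + v * r = 1) ->
  covered [set m | gauss_norm m <= 4 * gauss_norm r /\ gauss_dvd r (k + b * m)]
    (129 : R).
Proof.
move=> r0 [u [v uv]]; set A := (X in covered X).
have [[m0 [m0r m0d]]|nA] := pselect (exists m, A m); last first.
  by exists [::] => // x Ax; exfalso; apply: nA; exists x.
have /covered_ball/(covered_image (fun c => m0 + c * r)) : 0 <= 16 :> R by [].
apply: covered_le; last by rewrite -natrM natr1.
move=> m [mr md].
have [c cE] : gauss_dvd r (m - m0).
  have -> : m - m0 = v * (m - m0) * r + u * ((k + b * m) - (k + b * m0)).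
    by transitivity (1 * (m - m0)); [rewrite mul1r|rewrite -uv; ring].
  apply: gauss_dvdD; first by exists (v * (m - m0)).
  by apply/gauss_dvdMl/gauss_dvdD => //; exact: gauss_dvdN.
exists c; last by rewrite -cE addrC subrK.
rewrite /= -[leRHS]/((16%:Z)%:~R : R) ler_int.
have : gauss_norm c * gauss_norm r <= 16 * gauss_norm r.
  rewrite -gauss_normM -cE; apply: le_trans (gauss_normB_le m m0) _.
  by move: mr m0r => /=; lia.
by rewrite ler_pM2r//; move: r0; rewrite -gauss_norm_ge1; lia.
Qed.

(** The divisor d = p - q of m determines p + q = m / d, hence the pair. *)
Lemma covered_diff_sqr (R : realType) (m : gaussint) (x : R) : m != 0 ->
  covered [set d | gauss_dvd d m] x ->
  covered [set pq : gaussint * gaussint | pq.1 ^+ 2 - pq.2 ^+ 2 = m] x.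
Proof.
move=> m0 /(covered_bind (B := fun d => [set pq : gaussint * gaussint |
  pq.1 - pq.2 = d /\ pq.1 ^+ 2 - pq.2 ^+ 2 = m]) (@ler01 R)).
rewrite mulr1 => H; apply: covered_le (H _) => //; last first.
  move=> d dm; apply: covered_subsingleton => -[p q] [p' q'] /= [pq pqm] [pq' pqm'].
  have d0 : d != 0 by apply/eqP => d0; case: dm m0 => c ->; rewrite d0 mulr0 eqxx.
  have pqS : p + q = p' + q'.
    by apply: (gauss_mulfI d0); rewrite -{1}pq -pq' -!subr_sqr pqm pqm'.
  have two0 : 2%:R != 0 :> gaussint by [].
  have pp : p = p'.
    apply: (gauss_mulfI two0).
    transitivity ((p - q) + (p + q)); first by ring.
    by rewrite pq -pq' pqS; ring.
  by congr pair => //; move: pqS; rewrite pp => /addrI.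
move=> [p q] /= pqm; exists (p - q) => //.
by exists (p + q); rewrite mulrC -subr_sqr pqm.
Qed.

Lemma covered_sqr_eq (R : realType) (G : seq gaussint) :
  covered [set pq : gaussint * gaussint | pq.1 \in G /\ pq.1 ^+ 2 = pq.2 ^+ 2]
    ((size G)%:R * 2 : R).
Proof.
have H : covered [set p | p \in G] ((size G)%:R : R) by exists G.
apply: covered_le (covered_bind (B := fun p => [set (p, p); (p, - p)]) _ H _) => //.
  move=> [p q] /= [pG pq]; exists p => //=.
  have /eqP : (q - p) * (q + p) = 0 by rewrite -subr_sqr pq subrr.
  by rewrite gauss_mulf_eq0 subr_eq0 addr_eq0 => /orP[]/eqP ->; [left|right].
move=> p _; exists [:: (p, p); (p, - p)] => //.
by move=> z [] ->; rewrite !inE eqxx ?orbT.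
Qed.

Lemma sqr_le_linear (R : realType) (n F : R) : 0 <= F -> n ^+ 2 <= n * 2 + F ^+ 2 ->
  n <= 2 + F.
Proof. by move=> F0 nF; rewrite leNgt; apply/negP => Fn; nra. Qed.

(* With k(q) = A(q) q0^2 - b q^2, the difference k(p) - k(q) is small and
   determines b (p^2 - q^2) modulo q0^2, hence p^2 - q^2 up to O(1) choices, and
   then the divisor bound leaves few pairs (p, q). *)
Lemma card_denominators (R : realType) (eps : R) : 0 < eps ->
  exists2 C : R, 0 <= C &
    forall (L : nat) (q0 b : gaussint) (A : gaussint -> gaussint) (G : seq gaussint),
    (0 < L)%N -> q0 != 0 -> gauss_coprime b q0 -> uniq G ->
    (forall q, q \in G -> gauss_norm q <= gauss_norm q0 /\
      L%:Z ^+ 2 * gauss_norm (A q * q0 ^+ 2 - b * q ^+ 2) <=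
      2 * gauss_norm q ^+ 2 * gauss_norm q0 ^+ 2) ->
    (size G)%:R <=
      C * (gauss_norm q0)%:~R `^ eps * ((gauss_norm q0)%:~R ^+ 2 / L%:R + 1).
Proof.
move=> eps0; have [C C1 CP] := divisor_bound (divr_gt0 eps0 (ltr0n R 2)).
have C0 : 0 <= C := le_trans ler01 C1.
have e20 : 0 <= eps / 2 by rewrite divr_ge0 ?ltW.
exists (2 + 129 * 8 * C * 4 `^ (eps / 2)); first by rewrite addr_ge0 ?mulr_ge0 ?powR_ge0.
move=> L q0 b A G L0 q00 bq uG GP.
set P : R := (gauss_norm q0)%:~R.
have P1 : 1 <= P by rewrite ler1z gauss_norm_ge1.
have P0 : 0 <= P := le_trans ler01 P1.
have L0R : 0 < L%:R :> R by rewrite ltr0n.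
(* The divisor bound for m = p^2 - q^2, of norm at most 4 P^2; the exponent eps / 2 is chosen so
   that P^eps comes out. *)
set D := C * (4 * P ^+ 2) `^ (eps / 2).
have D1 : 1 <= D.
  have X1 : 1 <= 4 * P ^+ 2 by rewrite -[leLHS]mulr1 ler_pM ?ler1n ?exprn_ege1.
  by rewrite -[1]mulr1 ler_pM// -[leLHS](powRr0 (4 * P ^+ 2)) ler_powR.
have D0 : 0 <= D := le_trans ler01 D1.
have DE : D = C * 4 `^ (eps / 2) * P `^ eps.
  rewrite /D powRM ?exprn_ge0// -(powR_mulrn 2 P0) -powRrM mulrA.
  by rewrite mulrCA divff ?mulr1.
pose t := P ^+ 2 / L%:R; have t0 : 0 <= t by rewrite divr_ge0 ?exprn_ge0// ltW.
(* Each k(q) has norm at most 2 P^4 / L^2, and [gauss_normB_le] gives 2 (2 + 2) = 8 for a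
   difference. *)
pose K := 8 * P ^+ 4 / L%:R ^+ 2.
have K0 : 0 <= K by rewrite divr_ge0 ?mulr_ge0 ?exprn_ge0// ltW.
have KE : 8 * K + 1 <= (8 * t + 1) ^+ 2.
  have -> : K = 8 * t ^+ 2 by rewrite /K /t; field; rewrite gt_eqF.
  by nra.
have off : covered [set pq : gaussint * gaussint | [/\ pq.1 \in G, pq.2 \in G &
    pq.1 ^+ 2 != pq.2 ^+ 2]] ((8 * K + 1) * (129 * D)).
  pose B k := [set m | gauss_norm m <= 4 * gauss_norm (q0 ^+ 2) /\
    gauss_dvd (q0 ^+ 2) (k + b * m)].
  pose B' m := [set pq : gaussint * gaussint | m != 0 /\ pq.1 ^+ 2 - pq.2 ^+ 2 = m].
  have HB k : covered [set pq | exists2 m, B k m & B' m pq] (129 * D).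
    apply: covered_bind => //.
      by apply: covered_residue; [exact: gauss_expf_neq0|exact: gauss_coprimeX2].
    move=> m [mr _]; have [m0|m0] := eqVneq m 0.
      by exists [::] => // pq [/eqP].
    apply: covered_le (covered_diff_sqr m0 (CP m m0)); first by move=> pq [].
    rewrite ler_wpM2l// ge0_ler_powR ?nnegrE//.
    - by rewrite ler0z gauss_norm_ge0.
    - by rewrite mulr_ge0 ?exprn_ge0.
    by rewrite -[4]/((4%:Z)%:~R : R) -rmorphXn -rmorphM ler_int -gauss_normX.
  apply: covered_le (covered_bind _ (covered_ball K0) (fun k _ => HB k)) => //; last first.
    by rewrite mulr_ge0.
  move=> [p q] /= [pG qG pq].
  exists ((A p * q0 ^+ 2 - b * p ^+ 2) - (A q * q0 ^+ 2 - b * q ^+ 2)).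
    rewrite /= ler_pdivlMr ?exprn_gt0// mulrC.
    rewrite -[8]/((8%:Z)%:~R : R) -[L%:R]/((L%:Z)%:~R : R) -!rmorphXn -!rmorphM ler_int rmorphXn.
    apply: le_trans (ler_wpM2l (sqr_ge0 _) (gauss_normB_le _ _)) _.
    have [pq0 hp] := GP p pG; have [qq0 hq] := GP q qG.
    have h x : gauss_norm x <= gauss_norm q0 ->
        2 * gauss_norm x ^+ 2 * gauss_norm q0 ^+ 2 <= 2 * gauss_norm q0 ^+ 4.
      move=> xq; rewrite (exprD _ 2 2) mulrA ler_wpM2r ?sqr_ge0// ler_wpM2l//.
      by rewrite lerXn2r ?nnegrE ?gauss_norm_ge0.
    have {}hp := le_trans hp (h p pq0); have {}hq := le_trans hq (h q qq0).
    rewrite mulrCA mulrDr; apply: le_trans (ler_wpM2l _ (lerD hp hq)) _ => //.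
    by rewrite -mulrDl mulrA.
  exists (p ^+ 2 - q ^+ 2); split.
  - have [pq0 _] := GP p pG; have [qq0 _] := GP q qG.
    apply: le_trans (gauss_normB_le _ _) _; rewrite !gauss_normX.
    have h x : gauss_norm x <= gauss_norm q0 -> gauss_norm x ^+ 2 <= gauss_norm q0 ^+ 2.
      by move=> xq; rewrite lerXn2r ?nnegrE ?gauss_norm_ge0.
    apply: le_trans (ler_wpM2l _ (lerD (h p pq0) (h q qq0))) _ => //.
    by have -> : 2 * (gauss_norm q0 ^+ 2 + gauss_norm q0 ^+ 2) = 4 * gauss_norm q0 ^+ 2 by ring.
  - by exists (A p - A q); ring.
  - by rewrite subr_eq0.
  - by [].
pose F := 129 * D * (8 * t + 1).
have D129 : 0 <= 129 * D := mulr_ge0 (ler0n R 129) D0.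
have t81 : 0 <= 8 * t + 1 := addr_ge0 (mulr_ge0 (ler0n R 8) t0) ler01.
have F0 : 0 <= F := mulr_ge0 D129 t81.
(* All pairs from [G] are counted: at most two for each p when p^2 = q^2, and the others by [off].
   Since 129 D >= 1, it may be squared, which makes the second term a perfect square. *)
have nF : ((size G)%:R : R) ^+ 2 <= (size G)%:R * 2 + F ^+ 2.
  have EF : (8 * K + 1) * (129 * D) <= F ^+ 2.
    rewrite exprMn mulrC ler_pM// ?addr_ge0 ?mulr_ge0//.
    by rewrite expr2 ler_peMl// -[leLHS]mulr1 ler_pM ?ler1n.
  apply: le_trans (lerD (lexx _) EF).
  rewrite expr2 -natrM -(size_allpairs pair).
  apply: covered_size (covered_setU (covered_sqr_eq R G) off).
    by apply: allpairs_uniq => // -[? ?] [? ?].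
  move=> [p q] /allpairsP[[p' q'] /= [pG qG [-> ->]]].
  by have [pq|pq] := eqVneq (p' ^+ 2) (q' ^+ 2); [left|right].
apply: le_trans (sqr_le_linear F0 nF) _.
have Pe : 1 <= P `^ eps by rewrite -[leLHS](powRr0 P) ler_powR// ltW.
have Pt : 1 <= P `^ eps * (t + 1) by rewrite -[leLHS]mulr1 ler_pM// lerDr.
rewrite -mulrA mulrDl lerD//; first by rewrite ler_peMr.
rewrite -/t /F DE.
have -> : 129 * 8 * C * 4 `^ (eps / 2) * (P `^ eps * (t + 1)) =
  129 * (C * 4 `^ (eps / 2) * P `^ eps) * (8 * t + 8) by ring.
by rewrite ler_wpM2l ?mulr_ge0 ?powR_ge0// lerD2l ler1n.
Qed.

Lemma seq_norm_max (T : eqType) (f : T -> int) (s : seq T) : s != [::] ->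
  exists2 x, x \in s & forall y, y \in s -> f y <= f x.
Proof.
elim: s => // a [|b s] IH _.
  by exists a; rewrite ?mem_head// => y; rewrite inE => /eqP ->.
have [//|x xs xmax] := IH.
have [fax|fxa] := leP (f a) (f x).
  exists x; first by rewrite in_cons xs orbT.
  by move=> y; rewrite in_cons => /predU1P[->//|]; exact: xmax.
exists a; first exact: mem_head.
move=> y; rewrite in_cons => /predU1P[->//|/xmax fyx].
exact: le_trans (ltW fxa).
Qed.

(* Two fractions a / q^2 in one square of side 1 / L satisfy the last hypothesis. *)
Lemma card_cell_bound (R : realType) (eps : R) : 0 < eps ->
  exists2 C : R, 0 <= C &
    forall (Q : R) (L : nat) (X : seq (gaussint * gaussint)),
    1 <= Q -> (0 < L)%N -> uniq X ->
    (forall x, x \in X -> [/\ x.1 != 0, (gauss_norm x.1)%:~R <= Q &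
      gauss_coprime x.2 x.1]) ->
    (forall x y, x \in X -> y \in X ->
      L%:Z ^+ 2 * gauss_norm (x.2 * y.1 ^+ 2 - y.2 * x.1 ^+ 2) <=
      2 * gauss_norm x.1 ^+ 2 * gauss_norm y.1 ^+ 2) ->
    L%:R ^+ 2 * (size X)%:R <=
      C * Q `^ eps * (Q ^+ 3 + L%:R ^+ 2 + Q ^+ 2 * L%:R).
Proof.
move=> eps0; have [C C0 CP] := card_denominators eps0.
(* The two cases below: 153 = 9 * 17 from g <= 9 Q and 16 Q^2 + l^2 <= 17 Q^2 when l <= Q, and 17 C
   from 16 Q^2 + l^2 <= 17 l^2 when Q < l. *)
exists (153 + 17 * C); first by rewrite addr_ge0 ?mulr_ge0.
move=> Q L X Q1 L0 uX Xq Xcell.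
have Q0 : 0 <= Q := le_trans ler01 Q1.
have L0R : 0 < L%:R :> R by rewrite ltr0n.
have Qe : 1 <= Q `^ eps by rewrite -[leLHS](powRr0 Q) ler_powR// ltW.
have [->|X0] := eqVneq X [::].
  by rewrite mulr0 !mulr_ge0 ?powR_ge0 ?addr_ge0 ?mulr_ge0 ?exprn_ge0.
have [[q0 b] x0X x0max] := seq_norm_max (fun x => gauss_norm x.1) X0.
pose G := undup (map fst X).
have /choice[A AP] : forall q, exists a, q \in G -> (q, a) \in X.
  move=> q; have [qG|qG] := boolP (q \in G); last by exists 0.
  move: qG; rewrite mem_undup => /mapP[[q' a] qaX ->].
  by exists a.
have [/= q00 q0Q bq0] := Xq _ x0X.
have G1 : (size G)%:R <= C * Q `^ eps * (Q ^+ 2 / L%:R + 1).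
  have P0 : 0 <= (gauss_norm q0)%:~R :> R by rewrite ler0z gauss_norm_ge0.
  apply: le_trans (CP L q0 b A G L0 q00 bq0 (undup_uniq _) _) _.
    move=> q qG; have qX := AP q qG; split; first exact: (x0max _ qX).
    exact: (Xcell _ _ qX x0X).
  rewrite ler_pM ?mulr_ge0 ?powR_ge0 ?addr_ge0 ?divr_ge0 ?exprn_ge0//.
    by rewrite ler_wpM2l// ge0_ler_powR ?nnegrE// ltW.
  by rewrite lerD2r ler_wpM2r ?invr_ge0// lerXn2r ?nnegrE.
have G2 : (size G)%:R <= 8 * Q + 1.
  apply: covered_size (undup_uniq _) _ (covered_ball Q0).
  by move=> q; rewrite mem_undup => /mapP[x /Xq[_ + _] ->].
pose K := 2 * Q ^+ 2 / L%:R ^+ 2.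
have K0 : 0 <= K by rewrite divr_ge0 ?mulr_ge0 ?exprn_ge0.
(* For a fixed denominator q, the closeness hypothesis cancels to L^2 N(a - a') <= 2 N(q)^2, so the
   numerators lie in a disc around the chosen [A q]. *)
have XG : (size X)%:R <= (size G)%:R * (8 * K + 1).
  have HG : covered [set q | q \in G] ((size G)%:R : R) by exists G.
  apply: covered_size uX _ (covered_bind (B := fun q => [set x | x \in X /\ x.1 = q]) _ HG _).
  - move=> x xX; exists x.1 => //=; rewrite mem_undup; exact: map_f.
  - by rewrite addr_ge0 ?mulr_ge0.
  move=> q qG; apply: covered_le (covered_image (fun c => (q, A q + c)) (covered_ball K0)) => //.
  move=> [q' a] /= [qaX]; rewrite /= => q'E; rewrite {}q'E in qaX *.
  exists (a - A q); last by rewrite addrC subrK.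
  have [/= q00' qQ _] := Xq _ qaX.
  have /= := Xcell _ _ qaX (AP q qG).
  rewrite -mulrBl gauss_normM gauss_normX mulrA ler_pM2r; last first.
    by rewrite exprn_gt0// (lt_le_trans ltr01)// gauss_norm_ge1.
  move=> h; rewrite ler_pdivlMr ?exprn_gt0// mulrC.
  apply: le_trans (_ : 2 * (gauss_norm q)%:~R ^+ 2 <= _).
    rewrite -[2]/((2%:Z)%:~R : R) -[L%:R]/((L%:Z)%:~R : R).
    by rewrite -!rmorphXn -!rmorphM ler_int rmorphXn.
  by rewrite ler_wpM2l// lerXn2r ?nnegrE// ler0z gauss_norm_ge0.
have LX : L%:R ^+ 2 * (size X)%:R <= (size G)%:R * (16 * Q ^+ 2 + L%:R ^+ 2).
  apply: le_trans (ler_wpM2l (sqr_ge0 _) XG) _.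
  have -> : 16 * Q ^+ 2 = L%:R ^+ 2 * (8 * K) by rewrite /K; field; rewrite gt_eqF.
  by rewrite mulrCA mulrDr mulr1.
apply: (le_trans LX); set g := (size G)%:R in G1 G2 *; have g0 : 0 <= g by [].
set l : R := L%:R in L0R G1 *.
have [lQ|Ql] := leP l Q.
  have g9 : g <= 9 * Q by lra.
  have lQ2 : l ^+ 2 <= Q ^+ 2 by rewrite lerXn2r ?nnegrE ?(ltW L0R).
  apply: le_trans (_ : 153 * Q ^+ 3 <= _).
    have -> : 153 * Q ^+ 3 = 9 * Q * (17 * Q ^+ 2) by ring.
    by rewrite ler_pM ?addr_ge0 ?mulr_ge0 ?exprn_ge0 ?(ltW L0R)//; lra.
  rewrite ler_pM ?mulr_ge0 ?exprn_ge0//.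
    by rewrite -[leLHS]mulr1 ler_pM// lerDl mulr_ge0.
  by rewrite -addrA lerDl addr_ge0 ?mulr_ge0 ?exprn_ge0 ?(ltW L0R).
have lQ2 : Q ^+ 2 <= l ^+ 2 by rewrite lerXn2r ?nnegrE ?(ltW L0R) ?(ltW Ql).
apply: le_trans (_ : C * Q `^ eps * (Q ^+ 2 / l + 1) * (17 * l ^+ 2) <= _).
  by rewrite ler_pM ?addr_ge0 ?mulr_ge0 ?exprn_ge0 ?(ltW L0R)//; lra.
have -> : C * Q `^ eps * (Q ^+ 2 / l + 1) * (17 * l ^+ 2) =
  17 * C * Q `^ eps * (l ^+ 2 + Q ^+ 2 * l) by field; rewrite gt_eqF.
rewrite ler_pM ?mulr_ge0 ?addr_ge0 ?mulr_ge0 ?powR_ge0 ?exprn_ge0 ?(ltW L0R)//.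
  by rewrite ler_wpM2r ?powR_ge0// lerDr.
by rewrite -addrA lerDr exprn_ge0.
Qed.

(** * Additive characters and Parseval on the grid *)

Lemma e_unitD (R : realType) (x y : R) : e_unit (x + y) = e_unit x * e_unit y.
Proof. by rewrite /e_unit mulrDr cosD sinD; simpc; congr (_ +i* _); ring. Qed.

Lemma e_unit0 (R : realType) : e_unit (0 : R) = 1.
Proof. by rewrite /e_unit mulr0 cos0 sin0. Qed.

Lemma e_unit_nat (R : realType) (n : nat) : e_unit (n%:R : R) = 1.
Proof.
elim: n => [|n IH]; first exact: e_unit0.
rewrite -natr1 e_unitD IH mul1r /e_unit mulr1.
by rewrite mulr_natl cos2pi sin2pi.
Qed.

Lemma e_unit_int (R : realType) (n : int) : e_unit (n%:~R : R) = 1.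
Proof.
case: n => n; first exact: e_unit_nat.
rewrite NegzE -[LHS]mulr1 -[X in _ * X](e_unit_nat R n.+1) -e_unitD.
by rewrite rmorphN /= addNr e_unit0.
Qed.

Lemma e_unitMn (R : realType) (x : R) (n : nat) : e_unit (n%:R * x) = e_unit x ^+ n.
Proof.
elim: n => [|n IH]; first by rewrite mul0r e_unit0.
by rewrite -natr1 mulrDl mul1r e_unitD IH exprSr.
Qed.

Lemma e_unitN (R : realType) (x : R) : e_unit (- x) = (e_unit x)^*%R.
Proof. by rewrite /e_unit mulrN cosN sinN. Qed.

Lemma sqr_normc_complex (R : realType) (z : R[i]) : (normc z ^+ 2)%:C = z * z^*.
Proof.
case: z => a b; rewrite /normc sqr_sqrtr ?addr_ge0 ?sqr_ge0//; simpc.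
by congr (_ +i* _); ring.
Qed.

Lemma sqr_normcE (R : realType) (a b : R) : normc (a +i* b) ^+ 2 = a ^+ 2 + b ^+ 2.
Proof. by rewrite /normc sqr_sqrtr ?addr_ge0 ?sqr_ge0. Qed.

Lemma normc_ge0 (R : realType) (z : R[i]) : 0 <= normc z.
Proof. by case: z => a b; exact: sqrtr_ge0. Qed.

Lemma normc_e_unit (R : realType) (x : R) : normc (e_unit x) = 1.
Proof. by rewrite /normc /e_unit cos2Dsin2 sqrtr1. Qed.

Lemma norm_sin_le_id (R : realType) (x : R) : 0 <= x -> `|sin x| <= x.
Proof.
move=> x0.
have [|c _] := @MVT_segment R sin cos 0 x x0 (fun y _ => is_derive_sin y).
  by apply: continuous_subspaceT; exact: continuous_sin.
rewrite sin0 !subr0 => ->; rewrite normrM (ger0_norm x0) ler_piMl//.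
exact: cos_max.
Qed.

Lemma sqr_normc_e_unitB1 (R : realType) (x : R) :
  normc (e_unit x - 1) ^+ 2 = 4 * sin (pi * x) ^+ 2.
Proof.
rewrite /e_unit; simpc; rewrite sqr_normcE.
have -> : 2 * pi * x = (pi * x) *+ 2 by rewrite -mulrA mulr_natl.
by rewrite sin_mulr2n cos_mulr2n cos2sin2 !mulr2n; have := cos2Dsin2 (pi * x); nra.
Qed.

Lemma normc_e_unitB1_le (R : realType) (x : R) : 0 <= x ->
  normc (e_unit x - 1) <= 2 * pi * x.
Proof.
move=> x0; have px : 0 <= pi * x by rewrite mulr_ge0 ?pi_ge0.
rewrite -(@ler_pXn2r _ 2) ?nnegrE ?normc_ge0//; last by rewrite -mulrA mulr_ge0.
rewrite sqr_normc_e_unitB1.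
have -> : (2 * pi * x) ^+ 2 = 4 * (pi * x) ^+ 2 by ring.
rewrite ler_wpM2l// -(real_normK (num_real (sin _))) lerXn2r ?nnegrE//.
exact: norm_sin_le_id.
Qed.

Lemma e_unit_neq1 (R : realType) (x : R) : x != 0 -> `|x| < 1 -> e_unit x != 1.
Proof.
move=> x0 x1; rewrite -subr_eq0; apply/eqP => e1.
have := sqr_normc_e_unitB1 x; rewrite e1 normc0 expr0n /= => /esym/eqP.
rewrite mulf_eq0 pnatr_eq0 /= sqrf_eq0 => /eqP s0.
suff : 0 < sin (pi * `|x|).
  have -> : sin (pi * `|x|) = Num.sg x * sin (pi * x).
    by rewrite -sin_sg mulrCA -normrEsg.
  by rewrite s0 mulr0 ltxx.
apply: sin_gt0_pi; rewrite mulr_gt0 ?pi_gt0 ?normr_gt0//=.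
by rewrite gtr_pMr// pi_gt0.
Qed.

(** A geometric sum whose ratio e((n - m)/L) is an L-th root of unity, different from 1 for n != m
    because |n - m| < L. *)
Lemma sum_e_unit (R : realType) (L : nat) (n m : 'I_L) :
  \sum_(j < L) e_unit ((n%:R - m%:R) * (j%:R / L%:R) : R) =
  if n == m then L%:R else 0.
Proof.
have L0 : (0 < L)%N by case: L n {m} => // -[].
have L0R : 0 < L%:R :> R by rewrite ltr0n.
have [->|nm] := eqVneq n m.
  under eq_bigr do rewrite subrr mul0r e_unit0.
  by rewrite sumr_const card_ord.
pose z := e_unit ((n%:R - m%:R) / L%:R : R).
have zj (j : 'I_L) : e_unit ((n%:R - m%:R) * (j%:R / L%:R) : R) = z ^+ j.
  by rewrite -e_unitMn; congr e_unit; ring.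
under eq_bigr do rewrite zj.
have z1 : z != 1.
  apply: e_unit_neq1.
    by rewrite mulf_eq0 invr_eq0 (gt_eqF L0R) orbF subr_eq0 eqr_nat.
  rewrite normrM normfV (gtr0_norm L0R) ltr_pdivrMr// mul1r ltr_norml.
  have nL : n%:R < L%:R :> R by rewrite ltr_nat.
  have mL : m%:R < L%:R :> R by rewrite ltr_nat.
  have := ler0n R n; have := ler0n R m; lra.
apply: (mulfI (_ : z - 1 != 0)); first by rewrite subr_eq0.
rewrite mulr0 -subrX1 -e_unitMn mulrCA divff ?gt_eqF// mulr1.
by rewrite -[n%:R]/(n%:Z%:~R) -[m%:R]/(m%:Z%:~R) -rmorphB e_unit_int subrr.
Qed.

Lemma parseval (R : realType) (L : nat) (f : nat -> R[i]) :
  \sum_(j < L) normc (\sum_(n < L) f n * e_unit (n%:R * (j%:R / L%:R) : R)) ^+ 2 =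
  L%:R * \sum_(n < L) normc (f n) ^+ 2.
Proof.
apply: complexI; rewrite rmorphM !rmorph_sum /=.
under eq_bigr => j _.
  rewrite sqr_normc_complex rmorph_sum big_distrlr /=; over.
rewrite exchange_big mulr_sumr; apply: eq_bigr => n _.
rewrite exchange_big (bigD1 n)//= [X in _ + X]big1 ?addr0.
  under eq_bigr => j _.
    rewrite rmorphM /= -e_unitN mulrACA -e_unitD -sqr_normc_complex.
    rewrite -mulNr -mulrDl; over.
  rewrite -mulr_sumr sum_e_unit eqxx mulrC; congr (_ * _).
  by rewrite rmorph_nat.
move=> m mn.
under eq_bigr => j _.
  rewrite rmorphM /= -e_unitN mulrACA -e_unitD -mulNr -mulrDl; over.
by rewrite -mulr_sumr sum_e_unit eq_sym (negPf mn) mulr0.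
Qed.

(** * Partial summation and the maximum over a square *)

(** Nonnegativity of a variance: with W, A, B the three sums, the weighted sum of (W a_i - A)^2
    equals W (W B - A^2). *)
Lemma cauchy_weighted (R : realType) (L : nat) (w a : nat -> R) :
  0 < \sum_(i < L) w i -> (forall i, 0 <= w i) ->
  (\sum_(i < L) w i * a i) ^+ 2 <= (\sum_(i < L) w i) * \sum_(i < L) w i * a i ^+ 2.
Proof.
set W := \sum_(i < L) w i; set A := \sum_(i < L) w i * a i.
set B := \sum_(i < L) w i * a i ^+ 2 => W0 w0.
have : 0 <= \sum_(i < L) w i * (W * a i - A) ^+ 2.
  by apply: sumr_ge0 => i _; rewrite mulr_ge0 ?sqr_ge0.
have -> : \sum_(i < L) w i * (W * a i - A) ^+ 2 = W * (W * B - A ^+ 2).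
  have E x y : \sum_(i < L) w i * (x * a i - y) ^+ 2 =
      x ^+ 2 * B - 2 * x * y * A + y ^+ 2 * W.
    rewrite /A /B /W !mulr_sumr -sumrB -big_split /=.
    by apply: eq_bigr => i _; ring.
  by rewrite E; ring.
by rewrite pmulr_rge0// subr_ge0.
Qed.

Lemma normc_sum_le (R : realType) (I : Type) (s : seq I) (P : pred I) (F : I -> R[i]) :
  normc (\sum_(i <- s | P i) F i) <= \sum_(i <- s | P i) normc (F i).
Proof.
elim/big_ind2 : _ => [|x1 x2 y1 y2 h1 h2|//]; first by rewrite normc0.
by rewrite (le_trans (le_normcD _ _))// lerD.
Qed.

(** Majorants, uniform in 0 <= u <= 1/L, of the increments of n -> e(n u); index 0 carries the
    initial value e(0). Their total is at most 1 + 2 pi < 9. *)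
Definition abel_weight (R : realType) (L s : nat) : R :=
  if s is 0%N then 1 else 2 * pi / L%:R.

Lemma abel_weight_ge0 (R : realType) (L s : nat) : 0 <= abel_weight R L s.
Proof. by case: s => //= s; rewrite divr_ge0// mulr_ge0// pi_ge0. Qed.

Lemma sum_abel_weight (R : realType) (L : nat) : (0 < L)%N ->
  0 < \sum_(s < L) abel_weight R L s <= 9.
Proof.
case: L => // L _; rewrite big_ord_recl /=; apply/andP; split.
  by rewrite ltr_wpDr// sumr_ge0// => i _; exact: (abel_weight_ge0 R L.+1 i.+1).
rewrite sumr_const card_ord.
have p2 := pihalf_lt2 R.
have p8 : 2 * pi <= 8 :> R by lra.
apply: le_trans (_ : 1 + 2 * pi <= _); last by lra.
rewrite lerD2l -[_ *+ L]mulr_natr -mulrA ler_piMr ?mulr_ge0 ?pi_ge0//.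
by rewrite mulrC ler_pdivrMr// mul1r ler_nat.
Qed.

(* Partial summation: each frequency e(n u) telescopes into steps of size O(1 / L). *)
Lemma abel_bound (R : realType) (L : nat) (f : nat -> R[i]) (u : R) :
  (0 < L)%N -> 0 <= u <= L%:R^-1 ->
  normc (\sum_(n < L) f n * e_unit (n%:R * u)) ^+ 2 <=
  9 * \sum_(s < L) abel_weight R L s * normc (\sum_(n < L | (s <= n)%N) f n) ^+ 2.
Proof.
move=> L0 /andP[u0 uL].
pose d (s : nat) : R[i] :=
  if s is s'.+1 then e_unit (s'.+1%:R * u) - e_unit (s'%:R * u) else e_unit 0.
have dw s : normc (d s) <= abel_weight R L s.
  case: s => [|s]; first by rewrite normc_e_unit.
  rewrite /d /abel_weight -natr1 mulrDl mul1r e_unitD -[X in _ - X]mulr1 -mulrBr.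
  rewrite normcM normc_e_unit mul1r (le_trans (normc_e_unitB1_le u0))//.
  by rewrite ler_wpM2l// mulr_ge0// pi_ge0.
have dE n : \sum_(s < n.+1) d s = e_unit (n%:R * u).
  elim: n => [|n IH]; first by rewrite big_ord_recl big_ord0 mul0r addr0.
  by rewrite big_ord_recr /= IH addrC subrK.
(* With e(n u) written as the sum of [d s] over s <= n, exchanging the sums leaves tails of [f] in
   which u no longer occurs. The final bound is therefore the same for all u in the interval. *)
have -> : \sum_(n < L) f n * e_unit (n%:R * u) =
    \sum_(s < L) d s * \sum_(n < L | (s <= n)%N) f n.
  transitivity (\sum_(n < L) \sum_(s < L | (s <= n)%N) f n * d s).
    by apply: eq_bigr => n _; rewrite -dE (big_ord_widen L)// mulr_sumr.
  rewrite (exchange_big_dep xpredT)//=; apply: eq_bigr => s _.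
  by rewrite mulr_sumr; apply: eq_bigr => n _; rewrite mulrC.
pose a s := normc (\sum_(n < L | (s <= n)%N) f n).
have /andP[W0 W9] := sum_abel_weight R L0.
have w0 := abel_weight_ge0 R L.
have S0 : 0 <= \sum_(s < L) abel_weight R L s * a s ^+ 2.
  by apply: sumr_ge0 => s _; rewrite mulr_ge0 ?sqr_ge0.
apply: le_trans (ler_wpM2r S0 W9); apply: le_trans (cauchy_weighted a W0 w0).
rewrite lerXn2r ?nnegrE ?normc_ge0//.
  by apply: sumr_ge0 => s _; rewrite mulr_ge0 ?normc_ge0.
apply: le_trans (normc_sum_le _ _ _) _; apply: ler_sum => s _.
by rewrite normcM ler_wpM2r ?normc_ge0.
Qed.

Lemma parseval2 (R : realType) (L : nat) (c : nat -> nat -> R[i]) :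
  \sum_(j < L) \sum_(k < L) normc (\sum_(m < L) \sum_(n < L)
    c n m * e_unit (n%:R * (j%:R / L%:R) : R) * e_unit (m%:R * (k%:R / L%:R))) ^+ 2 =
  L%:R ^+ 2 * \sum_(n < L) \sum_(m < L) normc (c n m) ^+ 2.
Proof.
pose g (j m : nat) := \sum_(n < L) c n m * e_unit (n%:R * (j%:R / L%:R) : R).
transitivity (\sum_(j < L) L%:R * \sum_(m < L) normc (g j m) ^+ 2 : R).
  apply: eq_bigr => j _; rewrite -parseval; apply: eq_bigr => k _.
  by congr (normc _ ^+ 2); apply: eq_bigr => m _; rewrite mulr_suml.
rewrite -mulr_sumr exchange_big expr2 -mulrA [in RHS]exchange_big; congr (_ * _).
by rewrite mulr_sumr; apply: eq_bigr => m _; rewrite -(parseval L (fun n => c n m)).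
Qed.

(** [M j k] stands in for the maximum of the squared sum over the square with corner (j/L, k/L): an
    explicit majorant avoids any supremum. *)
Lemma large_sieve_cells (R : realType) (L : nat) (c : nat -> nat -> R[i]) :
  (0 < L)%N -> exists M : nat -> nat -> R,
  [/\ forall j k, 0 <= M j k,
    \sum_(j < L) \sum_(k < L) M j k <=
      9 ^+ 4 * L%:R ^+ 2 * \sum_(n < L) \sum_(m < L) normc (c n m) ^+ 2 &
    forall (j k : nat) (u v : R), 0 <= u <= L%:R^-1 -> 0 <= v <= L%:R^-1 ->
      normc (\sum_(n < L) \sum_(m < L) c n m *
        e_unit (n%:R * (j%:R / L%:R + u) + m%:R * (k%:R / L%:R + v))) ^+ 2 <= M j k].
Proof.
move=> L0; pose w := abel_weight R L; have w0 : forall s, 0 <= w s := abel_weight_ge0 R L.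
have /andP[W0 W9] := sum_abel_weight R L0.
(* A double tail of the sum is a full sum with truncated coefficients, so Parseval applies to it,
   and truncation only decreases the sum of squares. *)
pose c' (s t n m : nat) : R[i] := if (s <= n)%N && (t <= m)%N then c n m else 0.
pose T (s t j k : nat) := \sum_(m < L) \sum_(n < L) c' s t n m *
  e_unit (n%:R * (j%:R / L%:R) : R) * e_unit (m%:R * (k%:R / L%:R)).
(* The result of applying [abel_bound] in n and then in m. In 9^4, two factors are the ones visible
   here and two are the total weights in s and t. *)
exists (fun j k => 9 * \sum_(s < L) w s * (9 * \sum_(t < L) w t * normc (T s t j k) ^+ 2)).
split.
- move=> j k; rewrite mulr_ge0// sumr_ge0// => s _; rewrite mulr_ge0// mulr_ge0//.
  by rewrite sumr_ge0// => t _; rewrite mulr_ge0// sqr_ge0.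
- set S := \sum_(n < L) \sum_(m < L) normc (c n m) ^+ 2.
  have TS s t : \sum_(j < L) \sum_(k < L) normc (T s t j k) ^+ 2 <= L%:R ^+ 2 * S.
    rewrite /T parseval2 ler_wpM2l ?sqr_ge0//; apply: ler_sum => n _.
    apply: ler_sum => m _; rewrite /c'; case: ifP => // _.
    by rewrite normc0 expr0n sqr_ge0.
  have S0 : 0 <= S.
    by apply: sumr_ge0 => n _; apply: sumr_ge0 => m _; rewrite sqr_ge0.
  have -> : \sum_(j < L) \sum_(k < L)
        9 * (\sum_(s < L) w s * (9 * \sum_(t < L) w t * normc (T s t j k) ^+ 2)) =
      81 * \sum_(s < L) w s * \sum_(t < L) w t *
        \sum_(j < L) \sum_(k < L) normc (T s t j k) ^+ 2.
    have -> : 81 = 9 * 9 :> R by rewrite -natrM.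
    under eq_bigr do rewrite -mulr_sumr exchange_big.
    rewrite -mulr_sumr -mulrA exchange_big; congr (_ * _).
    rewrite mulr_sumr; apply: eq_bigr => s _; rewrite mulrCA.
    under eq_bigr do rewrite -mulr_sumr -mulr_sumr exchange_big.
    rewrite -mulr_sumr -mulr_sumr exchange_big; congr (_ * (_ * _)).
    by apply: eq_bigr => t _; rewrite mulr_sumr; apply: eq_bigr => j _; rewrite mulr_sumr.
  have W2 : \sum_(s < L) w s * \sum_(t < L) w t *
      \sum_(j < L) \sum_(k < L) normc (T s t j k) ^+ 2 <= 9 * (9 * (L%:R ^+ 2 * S)).
    apply: le_trans (_ : \sum_(s < L) w s * (9 * (L%:R ^+ 2 * S)) <= _); last first.
      by rewrite -mulr_suml ler_wpM2r// mulr_ge0// mulr_ge0 ?sqr_ge0.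
    apply: ler_sum => s _; rewrite ler_wpM2l//.
    apply: le_trans (_ : \sum_(t < L) w t * (L%:R ^+ 2 * S) <= _); last first.
      by rewrite -mulr_suml ler_wpM2r// mulr_ge0 ?sqr_ge0.
    by apply: ler_sum => t _; rewrite ler_wpM2l.
  apply: le_trans (ler_wpM2l _ W2) _ => //.
  have -> : 9 ^+ 4 * L%:R ^+ 2 * S = 81 * (9 * (9 * (L%:R ^+ 2 * S))) by ring.
  by [].
move=> j k u v u01 v01.
have -> : \sum_(n < L) \sum_(m < L) c n m *
    e_unit (n%:R * (j%:R / L%:R + u) + m%:R * (k%:R / L%:R + v)) =
  \sum_(n < L) (\sum_(m < L) c n m * e_unit (n%:R * (j%:R / L%:R)) *
    e_unit (m%:R * (k%:R / L%:R + v))) * e_unit (n%:R * u).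
  apply: eq_bigr => n _; rewrite mulr_suml; apply: eq_bigr => m _.
  by rewrite e_unitD [n%:R * (_ + u)]mulrDr e_unitD; ring.
apply: le_trans (abel_bound (fun n => \sum_(m < L) c n m * e_unit (n%:R * (j%:R / L%:R)) *
    e_unit (m%:R * (k%:R / L%:R + v))) L0 u01) _.
rewrite ler_wpM2l//; apply: ler_sum => s _; rewrite ler_wpM2l//.
rewrite exchange_big /=.
have -> : \sum_(m < L) \sum_(n < L | (s <= n)%N) c n m *
    e_unit (n%:R * (j%:R / L%:R)) * e_unit (m%:R * (k%:R / L%:R + v)) =
  \sum_(m < L) (\sum_(n < L | (s <= n)%N) c n m *
    e_unit (n%:R * (j%:R / L%:R)) * e_unit (m%:R * (k%:R / L%:R))) * e_unit (m%:R * v).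
  apply: eq_bigr => m _; rewrite mulr_suml; apply: eq_bigr => n _.
  by rewrite mulrDr e_unitD; ring.
apply: le_trans (abel_bound (fun m => \sum_(n < L | (s <= n)%N) c n m *
    e_unit (n%:R * (j%:R / L%:R)) * e_unit (m%:R * (k%:R / L%:R))) L0 v01) _.
rewrite ler_wpM2l//; apply: ler_sum => t _; rewrite ler_wpM2l//.
rewrite le_eqVlt; apply/orP; left; apply/eqP; congr (normc _ ^+ 2).
rewrite big_mkcond; apply: eq_bigr => m _; case: ifP => tm; last first.
  by rewrite big1// => n _; rewrite /c' tm andbF !mul0r.
rewrite big_mkcond; apply: eq_bigr => n _; rewrite /c' tm andbT.
by case: ifP => // _; rewrite !mul0r.
Qed.

(** * The fractions r/q^2 as points of the torus *)

Lemma gauss_complexM (R : realType) (x y : gaussint) :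
  gauss_complex R (x * y) = gauss_complex R x * gauss_complex R y.
Proof.
case: x y => [a b] [c d]; rewrite gauss_mulE /gauss_complex /=; simpc.
by rewrite rmorphB rmorphD !rmorphM.
Qed.

Lemma gauss_complexB (R : realType) (x y : gaussint) :
  gauss_complex R (x - y) = gauss_complex R x - gauss_complex R y.
Proof.
by case: x y => [a b] [c d]; rewrite /gauss_complex /=; simpc; rewrite !rmorphB.
Qed.

Lemma normc_gauss_complex (R : realType) (x : gaussint) :
  normc (gauss_complex R x) ^+ 2 = (gauss_norm x)%:~R.
Proof. by rewrite sqr_normcE rmorphD !rmorphXn. Qed.

Lemma gauss_complex_neq0 (R : realType) (x : gaussint) :
  x != 0 -> gauss_complex R x != 0.
Proof.
apply: contra_neq => x0; apply/eqP; rewrite -gauss_norm_eq0 -(eqr_int R).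
by rewrite -normc_gauss_complex x0 normc0 expr0n.
Qed.

Definition gfrac (R : realType) (x : R) : R := x - (Num.floor x)%:~R.

Lemma gfrac_itv (R : realType) (x : R) : 0 <= gfrac x < 1.
Proof.
have /andP[h1 h2] := floor_itv x.
by rewrite subr_ge0 h1 ltrBlDr addrC -[1]/(1%:~R) -rmorphD.
Qed.

(* The second coordinate is -Im so that Re (n z) = Re n * Re z + Im n * (- Im z). *)
Definition torus_re (R : realType) (x : gaussint * gaussint) : R :=
  gfrac (complex.Re (gauss_complex R x.2 / gauss_complex R (x.1 ^+ 2))).
Definition torus_im (R : realType) (x : gaussint * gaussint) : R :=
  gfrac (- complex.Im (gauss_complex R x.2 / gauss_complex R (x.1 ^+ 2))).

Definition torus_shift (R : realType) (x : gaussint * gaussint) : gaussint :=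
  let z := gauss_complex R x.2 / gauss_complex R (x.1 ^+ 2) in
  Num.floor (complex.Re z) -i* Num.floor (- complex.Im z).

(** The numerator congruent to r modulo q^2 whose quotient by q^2 lies in the fundamental square.
    With it, closeness of torus coordinates becomes closeness of complex numbers. *)
Definition torus_reduce (R : realType) (x : gaussint * gaussint) : gaussint :=
  x.2 - torus_shift R x * x.1 ^+ 2.

Lemma torus_reduceE (R : realType) (x : gaussint * gaussint) : x.1 != 0 ->
  gauss_complex R (torus_reduce R x) / gauss_complex R (x.1 ^+ 2) =
  torus_re R x -i* torus_im R x.
Proof.
move=> q0; have qR0 : gauss_complex R (x.1 ^+ 2) != 0.
  by apply: gauss_complex_neq0; exact: gauss_expf_neq0.
rewrite /torus_reduce gauss_complexB gauss_complexM mulrBl mulfK//.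
rewrite /torus_re /torus_im /gfrac /torus_shift.
set z := _ / _; case: z => a b; rewrite /gauss_complex /=; simpc.
by rewrite rmorphN /=; congr (_ +i* _); rewrite opprK; ring.
Qed.

(** The two fractions differ by a complex number of squared modulus at most 2 / L^2; multiply by q^2
    q'^2 and take norms. *)
Lemma cell_close (R : realType) (L : nat) (q r q' r' : gaussint) (x y x' y' : R) :
  (0 < L)%N -> q != 0 -> q' != 0 ->
  gauss_complex R r / gauss_complex R (q ^+ 2) = x -i* y ->
  gauss_complex R r' / gauss_complex R (q' ^+ 2) = x' -i* y' ->
  `|x - x'| <= L%:R^-1 -> `|y - y'| <= L%:R^-1 ->
  L%:Z ^+ 2 * gauss_norm (r * q' ^+ 2 - r' * q ^+ 2) <=
  2 * gauss_norm q ^+ 2 * gauss_norm q' ^+ 2.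
Proof.
move=> L0 q0 q0' rq rq' xx yy.
have L0R : 0 < L%:R :> R by rewrite ltr0n.
have qR0 : gauss_complex R (q ^+ 2) != 0.
  by apply: gauss_complex_neq0; exact: gauss_expf_neq0.
have qR0' : gauss_complex R (q' ^+ 2) != 0.
  by apply: gauss_complex_neq0; exact: gauss_expf_neq0.
have : gauss_complex R (r * q' ^+ 2 - r' * q ^+ 2) =
    ((x - x') -i* (y - y')) * (gauss_complex R (q ^+ 2) * gauss_complex R (q' ^+ 2)).
  have -> : (x - x') -i* (y - y') = (x -i* y) - (x' -i* y').
    by simpc; congr (_ +i* _); ring.
  by rewrite -rq -rq' gauss_complexB (gauss_complexM R r) (gauss_complexM R r'); field; rewrite qR0 qR0'.
move=> /(congr1 (fun z => normc z ^+ 2)); rewrite normc_gauss_complex.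
rewrite !normcM !exprMn !normc_gauss_complex sqr_normcE sqrrN.
rewrite !gauss_normX => E.
have sq (t : R) : `|t| <= L%:R^-1 -> L%:R ^+ 2 * t ^+ 2 <= 1.
  move=> tL; rewrite -(real_normK (num_real t)) -exprMn -[leRHS](expr1n _ 2).
  rewrite lerXn2r ?nnegrE ?mulr_ge0//.
  by rewrite mulrC -ler_pdivlMr// mul1r.
rewrite -(ler_int R) [leLHS]rmorphM /= E rmorphXn /=.
have -> : (2 * gauss_norm q ^+ 2 * gauss_norm q' ^+ 2)%:~R =
    2 * ((gauss_norm q ^+ 2)%:~R * (gauss_norm q' ^+ 2)%:~R) :> R.
  by rewrite -mulrA !rmorphM.
rewrite [leLHS]mulrA.
rewrite ler_wpM2r ?mulr_ge0 ?ler0z ?exprn_ge0 ?gauss_norm_ge0//.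
by rewrite mulrDr; exact: lerD (sq _ xx) (sq _ yy).
Qed.

Lemma cell_index (R : realType) (L : nat) (x : R) : 0 <= x < 1 ->
  (Num.truncn (L.+1%:R * x) < L.+1)%N /\
  0 <= x - (Num.truncn (L.+1%:R * x))%:R / L.+1%:R <= L.+1%:R^-1.
Proof.
move=> /andP[x0 x1]; have L0 : 0 < L.+1%:R :> R by rewrite ltr0n.
have Lx0 : 0 <= L.+1%:R * x by rewrite mulr_ge0.
have /andP[t1 t2] := truncn_itv Lx0; split.
  by rewrite truncn_lt_nat// gtr_pMr.
set t := _%:R in t1 *; have -> : x - t / L.+1%:R = (L.+1%:R * x - t) / L.+1%:R.
  by field; rewrite gt_eqF.
rewrite divr_ge0 ?subr_ge0//= ler_pdivrMr// mulVf ?gt_eqF//.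
by rewrite lerBlDr addrC natr1 ltW.
Qed.

(** Translates indices 0, ..., 2M to coordinates -M, ..., M, as partial summation and Parseval are
    set up for frequencies starting at 0. *)
Definition box_point (M i m : nat) : gaussint := (i%:Z - M%:Z) +i* (m%:Z - M%:Z).

Definition box_radius (R : realType) (N : R) : nat := Num.truncn (Num.sqrt N).

Lemma fsbig_ball (R : realType) (V : nmodType) (N : R) (F : gaussint -> V) : 0 <= N ->
  let M := box_radius N in let L := M.*2.+1 in
  \sum_(n \in [set n : gaussint | (gauss_norm n)%:~R <= N]) F n =
  \sum_(i < L) \sum_(m < L)
    if (gauss_norm (box_point M i m))%:~R <= N then F (box_point M i m) else 0.
Proof.
move=> N0 M L; pose s := [seq box_point M i m | i : 'I_L <- index_enum _,
  m : 'I_L <- index_enum _].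
have us : uniq s.
  apply: allpairs_uniq; rewrite ?index_enum_uniq//.
  move=> [i m] [i' m'] _ _ /= [/addIr[ii'] /addIr[mm']].
  by congr pair; exact: val_inj.
have -> : [set n : gaussint | (gauss_norm n)%:~R <= N] =
    [set` [seq n <- s | (gauss_norm n)%:~R <= N]].
  apply/seteqP; split=> [[x y]|n]; rewrite /= mem_filter; last by case/andP.
  move=> xyN; rewrite xyN /=; apply/allpairsP.
  have NM : N < (M.+1 ^ 2)%:R.
    have /andP[_ NM] := truncn_itv (sqrtr_ge0 N).
    by rewrite natrX -[N]sqr_sqrtr// ltrXn2r ?nnegrE ?sqrtr_ge0.
  have xyM : x ^+ 2 + y ^+ 2 < (M.+1 ^ 2)%:Z.
    by rewrite -(ltr_int R); exact: le_lt_trans NM.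
  have sqM (t : int) : t ^+ 2 < (M.+1 ^ 2)%:Z -> exists2 i : 'I_L, true & i%:Z - M%:Z = t.
    clear; move=> tM; have tL : (absz (t + M%:Z)%R < L)%N by rewrite /L; nia.
    by exists (Ordinal tL) => //=; nia.
  have [|i _ iE] := sqM x; first by rewrite (le_lt_trans _ xyM)// lerDl sqr_ge0.
  have [|m _ mE] := sqM y; first by rewrite (le_lt_trans _ xyM)// lerDr sqr_ge0.
  by exists (i, m); rewrite !mem_index_enum /box_point iE mE.
rewrite -fsbig_seq ?filter_uniq// big_filter big_mkcond.
by rewrite /s big_allpairs_dep.
Qed.

(** The translation by M multiplies the sum by a constant of modulus 1, and replacing r/q^2 by its
    torus coordinates changes each phase by an integer. *)
Lemma normc_exp_sum (R : realType) (N : R) (a : gaussint -> R[i])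
    (x : gaussint * gaussint) : 0 <= N ->
  let M := box_radius N in let L := M.*2.+1 in
  normc (\sum_(n \in [set n : gaussint | (gauss_norm n)%:~R <= N])
    a n * e_unit (complex.Re (gauss_complex R (n * x.2) / gauss_complex R (x.1 ^+ 2)))) =
  normc (\sum_(i < L) \sum_(m < L)
    (if (gauss_norm (box_point M i m))%:~R <= N then a (box_point M i m) else 0) *
    e_unit (i%:R * torus_re R x + m%:R * torus_im R x)).
Proof.
move=> N0 M L; rewrite fsbig_ball// -/M -/L.
pose s := - (M%:R * torus_re R x + M%:R * torus_im R x).
have sE z : normc z = normc (e_unit s * z) by rewrite normcM normc_e_unit mul1r.
rewrite [RHS]sE mulr_sumr; congr normc; apply: eq_bigr => i _.
rewrite mulr_sumr; apply: eq_bigr => m _.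
case: ifP => _; last by rewrite mul0r mulr0.
rewrite mulrCA -e_unitD /s; congr (_ * _).
rewrite gauss_complexM -mulrA /torus_re /torus_im /gfrac.
case: (gauss_complex R x.2 / _) => z1 z2; rewrite /gauss_complex /box_point /=.
set g := Num.floor z1; set h := Num.floor (- z2).
pose k : int := (i%:Z - M%:Z) * g + (m%:Z - M%:Z) * h.
have kE y : e_unit y = e_unit (y + k%:~R) by rewrite e_unitD e_unit_int mulr1.
rewrite [RHS]kE /k; congr e_unit.
rewrite !(rmorphD, rmorphN, rmorphM) /= -!pmulrn; ring.
Qed.

Lemma gauss_coprimeB (r q c : gaussint) :
  gauss_coprime r q -> gauss_coprime (r - c * q ^+ 2) q.
Proof.
move=> rq d dr dq; apply: rq => //.
rewrite -(subrK (c * q ^+ 2) r); apply: gauss_dvdD => //.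
by rewrite expr2 mulrA; exact: gauss_dvdMl.
Qed.

(** [card_cell_bound] is applied to the reduced numerators. Reduction is injective on [X], since
    equal reduced numerators over the same q come from congruent r. *)
Lemma card_torus_cell (R : realType) (eps : R) : 0 < eps ->
  exists2 C : R, 0 <= C &
    forall (Q : R) (L : nat) (X : seq (gaussint * gaussint)),
    1 <= Q -> (0 < L)%N -> uniq X ->
    (forall x, x \in X -> [/\ x.1 != 0, (gauss_norm x.1)%:~R <= Q &
      gauss_coprime x.2 x.1]) ->
    (forall x y, x \in X -> y \in X -> x.1 = y.1 ->
      gauss_dvd (x.1 ^+ 2) (x.2 - y.2) -> x = y) ->
    (forall x y, x \in X -> y \in X ->
      `|torus_re R x - torus_re R y| <= L%:R^-1 /\
      `|torus_im R x - torus_im R y| <= L%:R^-1) ->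
    L%:R ^+ 2 * (size X)%:R <=
      C * Q `^ eps * (Q ^+ 3 + L%:R ^+ 2 + Q ^+ 2 * L%:R).
Proof.
move=> eps0; have [C C0 CP] := card_cell_bound eps0.
exists C => // Q L X Q1 L0 uX Xq Xinj Xcell.
pose f (x : gaussint * gaussint) := (x.1, torus_reduce R x).
rewrite -(size_map f); apply: CP => //.
- rewrite map_inj_in_uniq// => x y xX yX [xy1 xy2].
  apply: Xinj => //; exists (torus_shift R x - torus_shift R y).
  rewrite -(subrK (torus_shift R x * x.1 ^+ 2) x.2).
  rewrite [x.2 - _]xy2.
  by rewrite /torus_reduce -xy1; ring.
- move=> _ /mapP[x /Xq[x0 xQ xc] ->]; split=> //.
  exact: gauss_coprimeB.
- move=> _ _ /mapP[x xX ->] /mapP[y yX ->] /=.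
  have [xy1 xy2] := Xcell _ _ xX yX.
  have [x0 _ _] := Xq _ xX; have [y0 _ _] := Xq _ yX.
  exact: cell_close (torus_reduceE R x0) (torus_reduceE R y0) xy1 xy2.
Qed.

Lemma same_cell (R : realType) (L : nat) (x y : R) : 0 <= x < 1 -> 0 <= y < 1 ->
  Num.truncn (L.+1%:R * x) = Num.truncn (L.+1%:R * y) -> `|x - y| <= L.+1%:R^-1.
Proof.
move=> /(cell_index L)[_ hx] /(cell_index L)[_ hy] xy; move: hx hy; rewrite -xy.
set t := _%:R / _; set e := _^-1 => /andP[x1 x2] /andP[y1 y2].
by rewrite ler_norml; apply/andP; split; lra.
Qed.

(** * Assembly of the estimates *)

Lemma finite_gauss_ball (R : realType) (Q : R) : 0 <= Q ->
  finite_set [set q : gaussint | q != 0 /\ (gauss_norm q)%:~R <= Q].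
Proof.
move=> /covered_ball[s _ sP]; apply: sub_finite_set (finite_seq s).
by move=> q [_ /sP].
Qed.

Lemma box_side_le (R : realType) (N : R) : 1 <= N ->
  (box_radius N).*2.+1%:R <= 3 * Num.sqrt N.
Proof.
move=> N1; have s1 : 1 <= Num.sqrt N by rewrite -[leLHS]sqrtr1 ler_wsqrtr.
have /andP[h _] := truncn_itv (sqrtr_ge0 N).
rewrite -natr1 -muln2 natrM /box_radius; lra.
Qed.

(** The term l^2 is O(N), and N <= sqrt(Q) N because Q >= 1. *)
Lemma cell_count_le (R : realType) (Q N l : R) : 1 <= Q -> 1 <= N -> 0 <= l ->
  l <= 3 * Num.sqrt N ->
  Q ^+ 3 + l ^+ 2 + Q ^+ 2 * l <=
  9 * (Q ^+ 3 + Q ^+ 2 * Num.sqrt N + Num.sqrt Q * N).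
Proof.
move=> Q1 N1 l0 lN; have Q0 := le_trans ler01 Q1; have N0 := le_trans ler01 N1.
have q1 : 1 <= Num.sqrt Q by rewrite -[leLHS]sqrtr1 ler_wsqrtr.
have sN : 0 <= Num.sqrt N by exact: sqrtr_ge0.
have l2 : l ^+ 2 <= 9 * N.
  rewrite -[in leRHS](sqr_sqrtr N0).
  have -> : 9 * Num.sqrt N ^+ 2 = (3 * Num.sqrt N) ^+ 2 by ring.
  by rewrite lerXn2r ?nnegrE ?mulr_ge0.
have l2q : l ^+ 2 <= 9 * (Num.sqrt Q * N).
  by apply: (le_trans l2); rewrite ler_wpM2l// ler_peMl.
have lq : Q ^+ 2 * l <= 9 * (Q ^+ 2 * Num.sqrt N).
  rewrite mulrCA ler_wpM2l ?sqr_ge0// (le_trans lN)// ler_wpM2r// ler_nat.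
  by [].
have q3 : Q ^+ 3 <= 9 * Q ^+ 3 by rewrite ler_peMl ?exprn_ge0// ler1n.
by rewrite mulrDr mulrDr addrAC lerD// lerD.
Qed.

Theorem theorem1 : forall (R : realType) (eps : R), 0 < eps ->
  exists C : R, 0 < C /\
    forall (Q N : R), 1 <= Q -> 1 <= N ->
    forall (a : gaussint -> R[i]) (reps : gaussint -> {fset gaussint}),
    (forall q : gaussint, q != 0 -> reduced_residues_sq q (reps q)) ->
    \sum_(q \in [set q : gaussint | q != 0 /\ (gauss_norm q)%:~R <= Q])
      \sum_(r <- reps q)
        normc (\sum_(n \in [set n : gaussint | (gauss_norm n)%:~R <= N])
                 a n * e_unit (complex.Re (gauss_complex R (n * r) /
                                   gauss_complex R (q ^+ 2)))) ^+ 2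
    <= C * (Q * N) `^ eps
         * (Q ^+ 3 + Q ^+ 2 * Num.sqrt N + Num.sqrt Q * N)
         * \sum_(n \in [set n : gaussint | (gauss_norm n)%:~R <= N])
             normc (a n) ^+ 2.
Proof.
move=> R eps eps0; have [C C0 CP] := card_torus_cell eps0.
have k0 n : 0 <= 9 ^+ n :> R by rewrite exprn_ge0.
(* 9^4 comes from [large_sieve_cells] and one more 9 from [cell_count_le]; the 1 ensures positivity,
   as [C] is only known to be nonnegative. *)
exists (9 ^+ 5 * C + 1); split; first exact: ltr_wpDl (mulr_ge0 (k0 5%N) C0) ltr01.
move=> Q N Q1 N1 a reps repsP.
have Q0 : 0 <= Q := le_trans ler01 Q1; have N0 : 0 <= N := le_trans ler01 N1.
have finA := finite_gauss_ball Q0.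
rewrite fsbig_finite//= -(big_allpairs_dep (h := pair)
  (F := fun x : gaussint * gaussint => normc (\sum_(n \in [set n : gaussint |
    (gauss_norm n)%:~R <= N]) a n * e_unit (complex.Re (gauss_complex R (n * x.2) /
    gauss_complex R (x.1 ^+ 2)))) ^+ 2)).
set X := [seq (q, r) | q <- _, r <- _].
have uX : uniq X.
  apply: allpairs_uniq_dep => [|q _|]; [exact: fset_uniq|exact: fset_uniq|].
  by move=> [q r] [q' r'] _ _ /= [-> ->].
have XP x : x \in X -> [/\ x.1 != 0, (gauss_norm x.1)%:~R <= Q & x.2 \in reps x.1].
  move=> /allpairsPdep[q [r [qA rq ->]]] /=; move: qA.
  by rewrite in_fset_set// inE /= => -[].
(* The same [L] counts the frequencies in each coordinate and the squares per side, as Parseval on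
   the grid requires. *)
set M := box_radius N; set L := M.*2.+1.
pose c (i m : nat) : R[i] :=
  if (gauss_norm (box_point M i m))%:~R <= N then a (box_point M i m) else 0.
have [W [W0 Wsum Wbound]] := large_sieve_cells c (ltn0Sn M.*2).
pose p1 x := Num.truncn (L%:R * torus_re R x).
pose p2 x := Num.truncn (L%:R * torus_im R x).
have p1L x : (p1 x < L)%N by apply: (cell_index _ _).1; exact: gfrac_itv.
have p2L x : (p2 x < L)%N by apply: (cell_index _ _).1; exact: gfrac_itv.
pose cell x : 'I_L * 'I_L := (Ordinal (p1L x), Ordinal (p2L x)).
pose K := C * Q `^ eps * (Q ^+ 3 + L%:R ^+ 2 + Q ^+ 2 * L%:R).
have L2 : 0 < L%:R ^+ 2 :> R by rewrite exprn_gt0// ltr0n.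
have cellK d : L%:R ^+ 2 * (size [seq x <- X | cell x == d])%:R <= K.
  apply: CP => //; first exact: filter_uniq.
  - move=> x; rewrite mem_filter => /andP[_ /XP[x0 xQ xr]]; split=> //.
    exact: (repsP _ x0).1.
  (* Two congruent numerators over one q both represent the class of [r], so uniqueness of
     representatives identifies them. *)
  - move=> [q r] [q' r']; rewrite !mem_filter => /andP[_ /XP[/= q0 _ rq]].
    move=> /andP[_ /XP[/= _ _ rq']] qq'; rewrite -{}qq' in rq' *; move=> /= rr'.
    have [rcop runiq] := repsP q q0.
    have [z [_ zuniq]] := runiq r (rcop r rq).
    have rr : gauss_dvd (q ^+ 2) (r - r) by exists 0; rewrite subrr mul0r.
    by rewrite -(zuniq r (conj rq rr)) -(zuniq r' (conj rq' rr')).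
  - move=> x y; rewrite !mem_filter => /andP[/eqP xd _] /andP[/eqP yd _].
    have [xy1 xy2] : p1 x = p1 y /\ p2 x = p2 y.
      by have := etrans xd (esym yd) => -[].
    by split; apply: same_cell => //; exact: gfrac_itv.
set S := \sum_(n \in _) _.
have SE : \sum_(n < L) \sum_(m < L) normc (c n m) ^+ 2 = S.
  rewrite /S fsbig_ball//; apply: eq_bigr => i _; apply: eq_bigr => m _.
  by rewrite /c; case: ifP => // _; rewrite normc0 expr0n.
rewrite SE in Wsum.
have S0 : 0 <= S.
  by rewrite -SE; apply: sumr_ge0 => i _; apply: sumr_ge0 => m _; exact: sqr_ge0.
(* Grouped by squares, each majorant occurs once for every point of its square, that is at most K /
   L^2 times. *)
have XS : L%:R ^+ 2 * \sum_(x <- X) W (p1 x) (p2 x) <=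
    K * \sum_(j < L) \sum_(k < L) W j k.
  rewrite pair_big /= (partition_big cell xpredT)//= !mulr_sumr.
  apply: ler_sum => d _.
  have -> : \sum_(x <- X | cell x == d) W (p1 x) (p2 x) =
      (size [seq x <- X | cell x == d])%:R * W d.1 d.2.
    rewrite (eq_bigr (fun _ => W d.1 d.2)) => [|x /eqP <-//].
    by rewrite big_const_seq size_filter iter_addr_0 mulr_natl.
  by rewrite mulrA ler_wpM2r.
have FX : \sum_(x <- X) normc (\sum_(n \in [set n : gaussint |
    (gauss_norm n)%:~R <= N]) a n * e_unit (complex.Re (gauss_complex R (n * x.2) /
    gauss_complex R (x.1 ^+ 2)))) ^+ 2 <= \sum_(x <- X) W (p1 x) (p2 x).
  apply: ler_sum => x _; rewrite normc_exp_sum// -/M -/L.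
  have := Wbound (p1 x) (p2 x) (torus_re R x - (p1 x)%:R / L%:R)
    (torus_im R x - (p2 x)%:R / L%:R).
  rewrite !(addrC _ (_ - _)) !subrK; apply.
    by apply: (cell_index _ _).2; exact: gfrac_itv.
  by apply: (cell_index _ _).2; exact: gfrac_itv.
apply: (le_trans FX); rewrite -(ler_pM2l L2); apply: (le_trans XS).
have K0 : 0 <= K.
  by rewrite mulr_ge0 ?mulr_ge0 ?powR_ge0// !addr_ge0 ?mulr_ge0 ?exprn_ge0.
apply: le_trans (ler_wpM2l K0 Wsum) _.
set B := Q ^+ 3 + _ + _; have B0 : 0 <= B.
  by rewrite !addr_ge0 ?mulr_ge0 ?exprn_ge0 ?sqrtr_ge0.
(* N >= 1 allows Q^eps to be enlarged to (Q N)^eps. *)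
have KB : K <= C * (Q * N) `^ eps * (9 * B).
  rewrite ler_pM ?mulr_ge0 ?powR_ge0 ?addr_ge0 ?mulr_ge0 ?exprn_ge0//.
    by rewrite ler_wpM2l// ge0_ler_powR ?nnegrE ?mulr_ge0 ?(ltW eps0)// ler_peMr.
  by apply: cell_count_le => //; exact: box_side_le.
apply: le_trans (ler_wpM2r (mulr_ge0 (mulr_ge0 (k0 4%N) (ltW L2)) S0) KB) _.
have -> : C * (Q * N) `^ eps * (9 * B) * (9 ^+ 4 * L%:R ^+ 2 * S) =
  L%:R ^+ 2 * (9 ^+ 5 * C * (Q * N) `^ eps * B * S) by ring.
rewrite ler_wpM2l ?(ltW L2)// ler_wpM2r// ler_wpM2r// ler_wpM2r ?powR_ge0//.
by rewrite lerDl.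
Qed.
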